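(* Consider observations $y_1,\dots,y_n\in\{0,1,2,\dots\}$ modeled as: independently for $i=1,\dots,n$, $y_i\mid\beta,\xi,\eta_i\sim\mathrm{Po}\big(\eta_i\exp(x_i^t\beta+g_i^t\xi_i)\big)$, with $\eta_1,\dots,\eta_n$ i.i.d. with density $f(\eta)=(1-s)\mathrm{Ga}(\eta\mid\alpha,\alpha)+sH(\eta)$ for fixed $s\in(0,1)$ and fixed $\alpha\ge1$, where $H(\eta)=\frac1\pi\frac{\{\log(1+\eta)\}^{-1/2}}{(1+\eta)\{1+\log(1+\eta)\}}$; here $x_i\in\mathbb R^p$, $g_i\in\mathbb R^q$ are fixed covariates, $\beta\in\mathbb R^p$, $\xi=(\xi_1,\dots,\xi_n)$ with $\xi_i\in\mathbb R^q$, and the prior is $\pi(\beta,\xi)=\pi_\beta(\beta)\pi_\xi(\xi)$ with $\pi_\beta$ a probability density on $\mathbb R^p$ and $\pi_\xi$ a (nondegenerate) multivariate normal density. Let $\{1,\dots,n\}=\mathcal K\cup\mathcal L$ be a partition into nonempty sets; $y_i$ is fixed for $i\in\mathcal K$, while $y_i=y_i(\omega)\to\infty$ as $\omega\to\infty$ for every $i\in\mathcal L$. Let $\mathcal K_+=\{i\in\mathcal K: y_i\ge1\}$ and assume $|\mathcal K_+|+1\ge|\mathcal L|+p$, and that any $p$ of the vectors $\{x_i:i\in\mathcal K_+\}$ are linearly independent. Then for every $(\beta,\xi)$, the posterior density satisfies $p(\beta,\xi\mid y)\to p(\beta,\xi\mid y_{\mathcal K})$ as $\omega\to\infty$, where $y=(y_1,\dots,y_n)$,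 $y_{\mathcal K}=(y_i)_{i\in\mathcal K}$, and $p(\beta,\xi\mid y_{\mathcal K})$ is the posterior based only on the observations indexed by $\mathcal K$ (with $\eta_i$ integrated out).
   Context: $\mathrm{Po}(\mu)$ is the Poisson distribution with mean $\mu$. $\mathrm{Ga}(\eta\mid\alpha,\beta)=\beta^\alpha\eta^{\alpha-1}e^{-\beta\eta}/\Gamma(\alpha)$ (shape $\alpha$, rate $\beta$). The posterior density is $p(\beta,\xi\mid y)\propto\pi(\beta,\xi)\prod_{i=1}^n\int_0^\infty f(u)\,\mathrm{Po}(y_i\mid u\exp(x_i^t\beta+g_i^t\xi_i))\,du$, and analogously for $p(\beta,\xi\mid y_{\mathcal K})$ with the product over $i\in\mathcal K$. *)

(* Defs.v *)
From HB Require Import structures.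
From mathcomp Require Import all_boot all_order all_algebra.
From mathcomp Require Import all_classical all_reals all_analysis.

Set Implicit Arguments.
Unset Strict Implicit.
Unset Printing Implicit Defensive.

Import Order.TTheory GRing.Theory Num.Theory.
Import numFieldNormedType.Exports.

Local Open Scope classical_set_scope.
Local Open Scope ring_scope.

Section Defs.
Context {R : realType}.

(* Integral over R^d (d.-tuple R, product Borel structure) w.r.t. Lebesgue
   measure, written as the iterated Lebesgue integral; by Tonelli this is the
   d-dimensional Lebesgue integral for nonnegative measurable integrands. *)
Fixpoint Rdint (d : nat) : (d.-tuple R -> \bar R) -> \bar R :=
  match d return (d.-tuple R -> \bar R) -> \bar R with
  | 0 => fun f => f [tuple]
  | d'.+1 => fun f =>
      (\int[@lebesgue_measure R]_x Rdint (fun v : d'.-tuple R => f (cons_tuple x v)))%E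
  end.

Definition GammaF (a : R) : R :=
  fine (\int[@lebesgue_measure R]_(t in `]0%R, +oo[%classic)
          (powR t (a - 1) * expR (- t))%:E)%E.

Definition gamma_pdf (a b u : R) : R :=
  powR b a * powR u (a - 1) * expR (- (b * u)) / GammaF a.

Definition H_pdf (u : R) : R :=
  pi^-1 * powR (ln (1 + u)) (- (2^-1)) / ((1 + u) * (1 + ln (1 + u))).

Definition mix_pdf (s a u : R) : R := (1 - s) * gamma_pdf a a u + s * H_pdf u.

Definition marg_lik (s a : R) (y : nat) (mu : R) : R :=
  fine (\int[@lebesgue_measure R]_(u in `]0%R, +oo[%classic)
          (mix_pdf s a u * poisson_pmf (u * mu) y)%:E)%E.

Definition dotp (k : nat) (v w : k.-tuple R) : R := \sum_(j < k) tnth v j * tnth w j.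

(* ξ ∈ R^(nq) is stored as one (n*q)-tuple; ξ_i is the i-th block of length q. *)
Definition xi_block (n q : nat) (xi : (n * q).-tuple R) (i : nat) : q.-tuple R :=
  [tuple nth 0 xi (i * q + j) | j < q].

Definition row_of (k : nat) (v : k.-tuple R) : 'rV[R]_k := \row_j tnth v j.

Definition posdef (k : nat) (Sigma : 'M[R]_k) : Prop :=
  Sigma^T = Sigma /\ forall v : 'rV[R]_k, v != 0 -> 0 < (v *m Sigma *m v^T) 0 0.

Definition mvn_pdf (k : nat) (m : 'rV[R]_k) (Sigma : 'M[R]_k) (v : k.-tuple R) : R :=
  (Num.sqrt ((pi *+ 2) ^+ k * \det Sigma))^-1 *
  expR (- (2^-1) * ((row_of v - m) *m invmx Sigma *m (row_of v - m)^T) 0 0).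

Definition prob_density (k : nat) (f : k.-tuple R -> R) : Prop :=
  measurable_fun setT f /\ (forall v, 0 <= f v) /\ Rdint (fun v => (f v)%:E) = 1%E.

Section Model.
Variables (n p q : nat) (x : 'I_n -> p.-tuple R) (g : 'I_n -> q.-tuple R)
  (s a : R) (pib : p.-tuple R -> R) (m : 'rV[R]_(n * q)) (Sigma : 'M[R]_(n * q)).

Definition rate (beta : p.-tuple R) (xi : (n * q).-tuple R) (i : 'I_n) : R :=
  expR (dotp (x i) beta + dotp (g i) (xi_block xi i)).

Definition lik (S : {set 'I_n}) (y : 'I_n -> nat) beta xi : R :=
  \prod_(i in S) marg_lik s a (y i) (rate beta xi i).

Definition upost (S : {set 'I_n}) (y : 'I_n -> nat) beta xi : R :=
  pib beta * mvn_pdf m Sigma xi * lik S y beta xi.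

(* normalizing constant (finite: integrand bounded by the prior density) *)
Definition evidence (S : {set 'I_n}) (y : 'I_n -> nat) : R :=
  fine (Rdint (fun beta => Rdint (fun xi => (upost S y beta xi)%:E))).

Definition posterior (S : {set 'I_n}) (y : 'I_n -> nat) beta xi : R :=
  upost S y beta xi / evidence S y.

End Model.

Definition lin_indep (n p : nat) (x : 'I_n -> p.-tuple R) (S : {set 'I_n}) : Prop :=
  forall c : 'I_n -> R,
    (forall j : 'I_p, \sum_(i in S) c i * tnth (x i) j = 0) ->
    forall i, i \in S -> c i = 0.

End Defs.

(* Main.v *)
(** Write [H] for the heavy-tailed mixture component.  Since [H u] is of order
    [1 / (u (log u)^(3/2))] at infinity, it is log-regularly varying:
    [c * H (c * y) / H y] tends to [1].  Integrating it against the Poisson weight,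
    which concentrates at [y / mu], the marginal likelihood at [y] is equivalent
    to [s * H y] whatever the rate, so each outlier contributes a constant factor
    that cancels in the posterior, provided that the limit can be exchanged with
    the normalizing integral.

    With [theta] the linear predictor and [w(theta) = (1 + |theta|)^(3/2)],
    submultiplicativity of [w] gives a domination: for [y >= 1] fixed the marginal
    likelihood is [O(1 / w(theta))], while divided by [H y] it is [O(w(theta))]
    uniformly in [y >= 2].  Any [p] of the covariates of positive counts being
    independent, in every direction of [beta] at most [p - 1] of these predictors
    stay small, hence at least [|L|] of the decaying factors compensate the [|L|]
    growing ones, up to a polynomial in [xi], which the normal prior integrates.
    Thus the integrand is bounded by [pi_beta(beta)] times an integrable function
    of [xi], and dominated convergence applies. *)

(* Since [pib] may have no moments, the domination must be uniform in [beta]: growing and decaying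
   weights have to cancel completely there, and only [xi] may leave a polynomial remainder. Hence
   the same weight [logw] in both bounds, and a trade between factors that rests on a count: once
   the at most [p - 1] small predictors are discarded, the cardinality hypothesis leaves at least
   [#|L|] large ones.

   Poisson concentration is obtained without Stirling estimates or tail splitting. As a function of
   [u], the Poisson weight at rate [u * mu] integrates to [1 / mu] whatever the count, and
   multiplying it by a power of [u * mu] only shifts the count and changes the coefficient. So
   [dev2 t = (t - 1)^2 (1 + t^-2)] has an explicit mean, of order [1 / k], and a pointwise bound of
   the mixture density by [A + B * dev2] integrates to a bound of the marginal likelihood. Both its
   limit and its uniform growth bound come out this way. The factor [1 + t^-2] in [dev2] is there
   because the density, relative to [H y], is controlled by [1 + t^-2] for small [t].

   The Gamma component is absorbed in [H]: for [a >= 1] it is [O(H u / (1 + u))]. *)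
Require Import Defs.
From HB Require Import structures.
From mathcomp Require Import all_boot all_order all_algebra.
From mathcomp Require Import all_classical all_reals all_analysis.
From mathcomp Require Import measurable_realfun ring lra.
Import Order.TTheory GRing.Theory Num.Theory.
Import numFieldNormedType.Exports.
Local Open Scope classical_set_scope.
Local Open Scope ring_scope.
Set Implicit Arguments.
Unset Strict Implicit.
Unset Printing Implicit Defensive.

(** * Iterated Lebesgue integrals *)

Section Rdint_theory.
Context {R : realType}.
Implicit Types d : nat.
Local Open Scope ereal_scope.
Local Notation leb := (@lebesgue_measure R).

Lemma measurable_cons_tuple d (c : R) :
  measurable_fun setT (fun v : d.-tuple R => cons_tuple c v).
Proof. exact: (@measurable_cons _ _ _ _ (fun=> c) _ id). Qed.

Lemma Rdint_ge0 d (f : d.-tuple R -> \bar R) :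
  (forall v, 0 <= f v) -> 0 <= Rdint f.
Proof.
elim: d f => [|d IH] f f0 /=; first exact: f0.
by apply: integral_ge0 => x _; apply: IH.
Qed.

Lemma eq_Rdint d (f g : d.-tuple R -> \bar R) : f =1 g -> Rdint f = Rdint g.
Proof. by move=> fg; congr Rdint; apply/funext. Qed.

(** The parameter space is arbitrary so that the induction can move one coordinate at a time into
    it, replacing [T] by [T * R]; each step is then one-variable Tonelli. *)
Lemma measurable_Rdint_param d (dT : measure_display) (T : measurableType dT)
    (f : T -> d.-tuple R -> \bar R) :
  measurable_fun setT (fun z : T * d.-tuple R => f z.1 z.2) ->
  (forall t v, 0 <= f t v) ->
  measurable_fun setT (fun t => Rdint (f t)).
Proof.
elim: d dT T f => [|d IH] dT T f mf f0 /=.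
  have := measurableT_comp mf (pair2_measurable (T1 := T) ([tuple] : 0.-tuple R)).
  exact.
apply: (@measurable_fun_fubini_tonelli_F _ _ _ _ _ leb
  (fun z : T * R => Rdint (fun v => f z.1 (cons_tuple z.2 v)))); last first.
  by move=> z; apply: Rdint_ge0.
apply: (IH _ _ (fun (z : T * R) v => f z.1 (cons_tuple z.2 v))) => //=.
apply: (measurableT_comp mf
  (g := fun w : (T * R) * d.-tuple R => (w.1.1, cons_tuple w.1.2 w.2))).
apply: measurable_fun_pair; first exact: measurableT_comp.
apply: (measurable_cons (f := fun w : (T * R) * d.-tuple R => w.1.2)
  (g := fun w => w.2)) => //; exact: measurableT_comp.
Qed.

Lemma measurable_Rdint_slice d (f : d.+1.-tuple R -> \bar R) :
  measurable_fun setT f -> (forall v, 0 <= f v) ->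
  measurable_fun setT (fun x => Rdint (fun v => f (cons_tuple x v))).
Proof.
move=> mf f0; apply: (measurable_Rdint_param (f := fun x v => f (cons_tuple x v))) => //.
apply: (measurableT_comp mf (g := fun w : R * d.-tuple R => cons_tuple w.1 w.2)).
exact: measurable_cons.
Qed.

Lemma measurable_slice d (f : d.+1.-tuple R -> \bar R) c :
  measurable_fun setT f -> measurable_fun setT (fun v => f (cons_tuple c v)).
Proof. by move=> mf; apply: measurableT_comp => //; exact: measurable_cons_tuple. Qed.

Lemma le_Rdint d (f g : d.-tuple R -> \bar R) :
  measurable_fun setT f -> measurable_fun setT g ->
  (forall v, 0 <= f v) -> (forall v, f v <= g v) -> Rdint f <= Rdint g.
Proof.
elim: d f g => [|d IH] f g mf mg f0 fg /=; first exact: fg.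
have g0 v : 0 <= g v by exact: le_trans (fg v).
apply: ge0_le_integral => //=.
- by move=> x _; apply: Rdint_ge0.
- exact: measurable_Rdint_slice.
- exact: measurable_Rdint_slice.
- by move=> x _; apply: IH => //; exact: measurable_slice.
Qed.

Lemma RdintZl d (f : d.-tuple R -> \bar R) (k : R) : (0 <= k)%R ->
  measurable_fun setT f -> (forall v, 0 <= f v) ->
  Rdint (fun v => k%:E * f v) = k%:E * Rdint f.
Proof.
move=> k0; elim: d f => [|d IH] f mf f0 //=.
rewrite -ge0_integralZl_EFin//=.
- by apply: eq_integral => x _; rewrite IH//; exact: measurable_slice.
- by move=> x _; apply: Rdint_ge0.
- exact: measurable_Rdint_slice.
Qed.

(** A null iterated integral has null inner integrals almost everywhere, and this descends through
    the dimensions. It serves to prove that the evidence is nonzero, with [g] equal to [pib] or to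
    1. *)
Lemma Rdint_eq0_sub d (f g : d.-tuple R -> \bar R) :
  measurable_fun setT f -> measurable_fun setT g ->
  (forall v, 0 <= f v) -> (forall v, 0 <= g v) ->
  (forall v, f v = 0 -> g v = 0) -> Rdint f = 0 -> Rdint g = 0.
Proof.
elim: d f g => [|d IH] f g mf mg f0 g0 fg /=; first exact: fg.
have F0 x : 0 <= Rdint (fun v => f (cons_tuple x v)) by exact: Rdint_ge0.
have G0 x : 0 <= Rdint (fun v => g (cons_tuple x v)) by exact: Rdint_ge0.
move=> If.
have : ae_eq leb setT (fun x => Rdint (fun v => f (cons_tuple x v))) (cst 0).
  apply/(ae_eq_integral_abs leb measurableT (measurable_Rdint_slice mf f0)).
  by rewrite -[RHS]If; apply: eq_integral => x _; rewrite gee0_abs.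
move=> aeF.
rewrite (_ : 0 = \int[leb]_(x in setT) (cst 0 x)); last by rewrite integral_cst ?mul0e.
apply: ge0_ae_eq_integral => //; first exact: measurable_Rdint_slice.
apply: filterS aeF => x /= Fx _; apply: IH (Fx I) => //.
- exact: measurable_slice.
- exact: measurable_slice.
- by move=> v; exact: fg.
Qed.

(** The value is 1 in dimension 0 and infinite otherwise; being nonzero is what both cases share. *)
Lemma Rdint_cst1_neq0 d : Rdint (fun _ : d.-tuple R => 1) != 0.
Proof.
elim: d => [|d IH] /=; first exact: onee_neq0.
rewrite integral_cst//; apply/eqP => /eqP; rewrite mule_eq0 (negbTE IH)/=.
have : 1 <= leb setT.
  have <- : leb `[0%R, 1%R] = 1 by rewrite lebesgue_measure_itv/= lte01 oppr0 adde0.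
  by apply: le_measure; rewrite ?inE.
by move=> h /eqP h'; rewrite h' lee_fin ler10 in h.
Qed.

Lemma Rdint_prod d (e : R -> R) (I : R) :
  (forall z, 0 <= e z)%R -> measurable_fun setT e ->
  \int[leb]_z (e z)%:E = I%:E ->
  Rdint (fun v : d.-tuple R => (\prod_(i < d) e (tnth v i))%:E) = (I ^+ d)%:E.
Proof.
move=> e0 me Ie; elim: d => [|d IH] /=; first by rewrite big_ord0 expr0.
have mp : measurable_fun setT (fun v : d.-tuple R => (\prod_(i < d) e (tnth v i))%:E).
  apply/measurable_EFinP; apply: measurable_prod => i _.
  by apply: measurableT_comp => //; exact: measurable_tnth.
transitivity (\int[leb]_x ((e x)%:E * (I ^+ d)%:E)).
  apply: eq_integral => x _; rewrite -IH -RdintZl//; last first.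
    by move=> v; rewrite lee_fin prodr_ge0.
  apply: eq_Rdint => v; rewrite big_ord_recl -EFinM /=; congr (_ * _)%:E%R.
  by apply: eq_bigr => i _; rewrite tnthS.
have I0 : (0 <= I)%R.
  by rewrite -lee_fin -Ie; apply: integral_ge0 => x _; rewrite lee_fin.
rewrite exprS EFinM -Ie; apply: ge0_integralZr => //=; first exact/measurable_EFinP.
- by move=> x _; rewrite lee_fin.
- by rewrite lee_fin exprn_ge0.
Qed.

Lemma Rdint_dominated_convergence d (f_ : nat -> d.-tuple R -> \bar R)
    (f G : d.-tuple R -> \bar R) :
  (forall k, measurable_fun setT (f_ k)) -> measurable_fun setT f ->
  measurable_fun setT G ->
  (forall k v, 0 <= f_ k v) -> (forall k v, f_ k v <= G v) ->
  (forall v, f_ ^~ v @ \oo --> f v) -> Rdint G < +oo ->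
  Rdint f < +oo /\ (fun k => Rdint (f_ k)) @ \oo --> Rdint f.
Proof.
elim: d f_ f G => [|d IH] f_ f G mf_ mf mG f0 fG cf /= IG.
  split; last exact: cf.
  apply: le_lt_trans IG; apply: (cvge_to_le (cf [tuple])).
  by near=> k; exact: fG.
have G0 v : 0 <= G v by exact: le_trans (fG 0%N v).
have flim0 v : 0 <= f v.
  by apply: (cvge_to_ge (cf v)); near=> k; exact: f0.
have iG : leb.-integrable setT (fun x => Rdint (fun v => G (cons_tuple x v))).
  apply/integrableP; split; first exact: measurable_Rdint_slice.
  apply: le_lt_trans IG; apply: ge0_le_integral => //.
  - by apply: measurableT_comp => //; exact: measurable_Rdint_slice.
  - exact: measurable_Rdint_slice.
  - by move=> x _; rewrite gee0_abs//; apply: Rdint_ge0.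
have aeG := integrable_ae measurableT iG.
have [H1 H2 H3] : [/\ leb.-integrable setT (fun x => Rdint (fun v => f (cons_tuple x v))),
  [sequence \int[leb]_x `|Rdint (fun v => f_ n (cons_tuple x v)) -
     Rdint (fun v => f (cons_tuple x v))|]_n @ \oo --> 0 &
  [sequence \int[leb]_x Rdint (fun v => f_ n (cons_tuple x v))]_n @ \oo -->
    \int[leb]_x Rdint (fun v => f (cons_tuple x v)) ].
  apply: (@dominated_convergence _ _ _ leb setT measurableT
    (fun n x => Rdint (fun v => f_ n (cons_tuple x v))) _
    (fun x => Rdint (fun v => G (cons_tuple x v)))) => //.
  - by move=> n; exact: measurable_Rdint_slice.
  - exact: measurable_Rdint_slice.
  (* The slices of [G] have a finite integral for almost every [x] only, so the induction hypothesis
     gives convergence almost everywhere. *)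
  - apply: filterS aeG => x /= /(_ I) Gx _.
    apply: (proj2 (IH (fun k v => f_ k (cons_tuple x v))
      (fun v => f (cons_tuple x v)) (fun v => G (cons_tuple x v)) _ _ _ _ _ _ _)) => //.
    + by move=> k; exact: measurable_slice.
    + exact: measurable_slice.
    + exact: measurable_slice.
    + by rewrite ltey_eq Gx.
  - apply: aeW => x n _; rewrite gee0_abs; last exact: Rdint_ge0.
    by apply: le_Rdint => //; exact: measurable_slice.
split; last exact: H3.
by have /integrable_lty := H1; apply.
Unshelve. all: by end_near. Qed.

End Rdint_theory.

(** * The heavy-tailed density *)

Section log_weight.
Context {R : realType}.
Implicit Types (c t u v w y z : R) (N : nat).

Definition pow32 w : R := w * Num.sqrt w.

Lemma pow32_gt0 w : 0 < w -> 0 < pow32 w.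
Proof. by move=> w0; rewrite mulr_gt0// sqrtr_gt0. Qed.

Lemma le_pow32 w z : 0 <= w -> w <= z -> pow32 w <= pow32 z.
Proof. by move=> w0 wz; rewrite ler_pM// ler_wsqrtr. Qed.

Lemma pow32M w z : 0 <= w -> pow32 (w * z) = pow32 w * pow32 z.
Proof. by move=> w0; rewrite /pow32 sqrtrM// mulrACA. Qed.

Lemma pow32_prod (I : finType) (S : {set I}) (F : I -> R) :
  (forall i, 0 <= F i) -> pow32 (\prod_(i in S) F i) = \prod_(i in S) pow32 (F i).
Proof.
move=> F0; suff [] : pow32 (\prod_(i in S) F i) = \prod_(i in S) pow32 (F i) /\
  0 <= \prod_(i in S) F i by [].
elim/big_ind2 : _ => [|x1 x2 y1 y2 [e1 p1] [e2 p2]|i _]; last by [].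
- by rewrite /pow32 sqrtr1 mulr1.
- by rewrite pow32M// e1 e2; split => //; rewrite -?e1 -?e2 mulr_ge0.
Qed.

Lemma sqrtr_le_sqr w z : 0 <= z -> w <= z ^+ 2 -> Num.sqrt w <= z.
Proof. by move=> z0 h; rewrite -[leRHS]ger0_norm// -sqrtr_sqr ler_wsqrtr. Qed.

(* The decay of [u * H_pdf u] in [ln u]; submultiplicativity ([logwD]) is what
   turns it into bounds in the linear predictor. *)
Definition logw z : R := pow32 (1 + `|z|).

Lemma logw_gt0 z : 0 < logw z.
Proof. by rewrite pow32_gt0// ltr_wpDr. Qed.

Lemma logwN z : logw (- z) = logw z.
Proof. by rewrite /logw normrN. Qed.

Lemma logwD w z : logw (w + z) <= logw w * logw z.
Proof.
rewrite /logw -pow32M; last by rewrite addr_ge0.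
apply: le_pow32; first by rewrite addr_ge0.
have := ler_normD w z; have := normr_ge0 w; have := normr_ge0 z.
by nra.
Qed.

Lemma expr_le_expR N w : 0 <= w -> w ^+ N <= N`!%:R * expR w.
Proof.
move=> w0; case: N => [|N].
  by rewrite expr0 fact0 mul1r -[leLHS]expR0 ler_expR.
rewrite mulrC -ler_pdivrMr; last by rewrite ltr0n fact_gt0.
by apply: le_trans (expR_ge1Dxn N w0); rewrite lerDr.
Qed.

Lemma polyM_expRN_bounded N c : 0 < c ->
  exists2 C : R, 0 < C & forall w, 0 <= w -> (1 + w) ^+ N * expR (- (c * w)) <= C.
Proof.
move=> c0; exists (N`!%:R * expR c / c ^+ N).
  by rewrite divr_gt0 ?exprn_gt0// mulr_gt0 ?expR_gt0// ltr0n fact_gt0.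
move=> w w0; rewrite ler_pdivlMr ?exprn_gt0//.
have h := @expr_le_expR N (c * (1 + w)) (mulr_ge0 (ltW c0) (addr_ge0 ler01 w0)).
rewrite exprMn mulrDr mulr1 expRD in h.
rewrite expRN mulrAC ler_pdivrMr ?expR_gt0//.
by rewrite mulrC mulrA in h *.
Qed.

(** Squaring [1 + |z| <= 4 exp (|z| / 4)] gives [logw z <= 16 exp (|z| / 2)]; at [z = ln t] the
    exponential is the larger of [sqrt t] and its inverse. *)
Lemma logw_ln_sqrt t : 0 < t -> logw (ln t) * Num.sqrt t <= 16 * (1 + t).
Proof.
move=> t0.
have h z : logw z <= 16 * expR (`|z| / 2).
  have z0 := normr_ge0 z.
  apply: (@le_trans _ _ ((1 + `|z|) ^+ 2)).
    rewrite /logw /pow32 expr2 ler_wpM2l ?addr_ge0//.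
    by apply: sqrtr_le_sqr; nra.
  have -> : expR (`|z| / 2) = expR (`|z| / 4) ^+ 2.
    by rewrite -expRM_natl; congr expR; lra.
  have := expR_ge1Dx (`|z| / 4); set e := expR _ => he; nra.
have es : expR (ln t / 2) = Num.sqrt t.
  rewrite -[LHS]ger0_norm ?expR_ge0// -sqrtr_sqr; congr Num.sqrt.
  by rewrite -expRM_natl mulrC divfK// lnK.
have s0 : 0 < Num.sqrt t by rewrite sqrtr_gt0.
have s2 : Num.sqrt t ^+ 2 = t by rewrite sqr_sqrtr// ltW.
apply: (@le_trans _ _ (16 * expR (`|ln t| / 2) * Num.sqrt t)).
  by rewrite ler_wpM2r// ltW.
have [l0|l0] := leP 0 (ln t).
  by rewrite (ger0_norm l0) es -mulrA -expr2 s2; lra.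
by rewrite (ltr0_norm l0) mulNr expRN es divfK ?gt_eqF//; lra.
Qed.

(** Trades a logarithmic weight for [1 + t^-2], the form that [dev2] can control. *)
Lemma logw_ln_div t : 0 < t -> logw (ln t) / t <= 32 * (1 + t ^- 2).
Proof.
move=> t0; have s0 : 0 < Num.sqrt t by rewrite sqrtr_gt0.
have s2 : Num.sqrt t ^+ 2 = t by rewrite sqr_sqrtr// ltW.
have h := logw_ln_sqrt t0.
have hs : t <= Num.sqrt t * (1 + t) by move: s0 s2; set r : R := Num.sqrt t; nra.
have p0 := logw_gt0 (ln t).
have : logw (ln t) * t <= 16 * (1 + t) ^+ 2.
  apply: (@le_trans _ _ (logw (ln t) * (Num.sqrt t * (1 + t)))).
    by rewrite ler_pM2l.
  by rewrite mulrA expr2 mulrA ler_wpM2r//; lra.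
move=> h2.
have -> : 1 + t ^- 2 = (t ^+ 2 + 1) / t ^+ 2 by field; rewrite gt_eqF.
rewrite ler_pdivrMr// mulrA mulrAC ler_pdivlMr ?exprn_gt0//.
have := ler_wpM2r (ltW t0) h2; have := mulr_ge0 (sqr_ge0 (t - 1)) (ltW t0).
by nra.
Qed.

End log_weight.

(** * Two-sided bounds and log-regular variation of the heavy-tailed density *)

Section H_pdf.
Context {R : realType}.
Implicit Types (c t u v w y z : R) (N : nat).
Local Notation H := (@H_pdf R).
Local Notation L u := (ln (1 + u)).

Lemma pi_ge1 : 1 <= pi :> R.
Proof. by apply: le_trans (pi_ge2 R); lra. Qed.

Lemma ln1D_gt0 u : 0 < u -> 0 < L u.
Proof. by move=> u0; rewrite ln_gt0// ltrDl. Qed.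

Lemma le_ln1D u v : 0 < u -> u <= v -> L u <= L v.
Proof. by move=> u0 uv; rewrite ler_ln ?posrE ?lerD2l//; lra. Qed.

Lemma H_pdfE u : 0 < u ->
  H u = (pi * Num.sqrt (L u) * (1 + u) * (1 + L u))^-1.
Proof.
move=> u0; have l0 := ln1D_gt0 u0.
rewrite /H_pdf powRN powR12_sqrt ?ltW// !invfM; ring.
Qed.

Lemma H_pdf_den_gt0 u : 0 < u -> 0 < pi * Num.sqrt (L u) * (1 + u) * (1 + L u).
Proof.
move=> u0; have l0 := ln1D_gt0 u0.
by rewrite !mulr_gt0 ?pi_gt0 ?sqrtr_gt0//; lra.
Qed.

Lemma H_pdf_gt0 u : 0 < u -> 0 < H u.
Proof. by move=> u0; rewrite H_pdfE// invr_gt0 H_pdf_den_gt0. Qed.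

Lemma H_pdf_ge0 u : 0 <= u -> 0 <= H u.
Proof.
move=> u0; rewrite /H_pdf !mulr_ge0 ?invr_ge0 ?pi_ge0 ?powR_ge0//.
have : 0 <= L u by rewrite ln_ge0// lerDl.
by move=> l0; apply: mulr_ge0; lra.
Qed.

(** Both logarithms are bounded by [u]. The factor [sqrt u] is kept because it pairs with
    [logw_ln_sqrt] near 0. *)
Lemma H_pdf_lbound u : 0 < u -> (pi * Num.sqrt u * (1 + u) ^+ 2)^-1 <= H u.
Proof.
move=> u0; have l0 := ln1D_gt0 u0.
have lu : L u <= u by apply: le_ln1Dx; lra.
rewrite H_pdfE// lef_pV2 ?posrE ?H_pdf_den_gt0//; last first.
  by rewrite !mulr_gt0 ?pi_gt0 ?sqrtr_gt0 ?exprn_gt0//; lra.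
rewrite expr2 mulrA.
have p0 := pi_gt0 R; have su : 0 < Num.sqrt u by rewrite sqrtr_gt0.
have sl : 0 < Num.sqrt (L u) by rewrite sqrtr_gt0.
apply: ler_pM; rewrite ?lerD2l//; [by rewrite !mulr_ge0//; lra|lra|].
by rewrite ler_pM2r ?ler_pM2l ?ler_wsqrtr//; lra.
Qed.

Lemma H_pdf_lbound3 u : 0 < u -> (pi * (1 + u) ^+ 3)^-1 <= H u.
Proof.
move=> u0; apply: le_trans (H_pdf_lbound u0).
have p0 := pi_gt0 R; have su : 0 < Num.sqrt u by rewrite sqrtr_gt0.
have s2 : Num.sqrt u ^+ 2 = u by rewrite sqr_sqrtr// ltW.
rewrite lef_pV2 ?posrE ?mulr_gt0 ?exprn_gt0//; try lra.
rewrite [leRHS](_ : _ = pi * (1 + u) * (1 + u) ^+ 2); last by ring.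
rewrite ler_wpM2r ?ler_pM2l ?exprn_ge0//; first lra.
by rewrite -[in leRHS]s2; nra.
Qed.

Lemma H_pdf_nincr u v : 0 < u -> u <= v -> H v <= H u.
Proof.
move=> u0 uv; have v0 : 0 < v by lra.
have lu := ln1D_gt0 u0; have luv := le_ln1D u0 uv.
have p0 := pi_gt0 R.
rewrite !H_pdfE// lef_pV2 ?posrE ?H_pdf_den_gt0//.
have sl : 0 < Num.sqrt (L u) by rewrite sqrtr_gt0.
apply: ler_pM; [by rewrite !mulr_ge0//; lra|lra| |lra].
apply: ler_pM; [by rewrite !mulr_ge0//; lra|lra| |lra].
by rewrite ler_pM2l// ler_wsqrtr.
Qed.

Lemma measurable_H_pdf : measurable_fun (`]0, +oo[%classic : set R) H.
Proof.
have mL : measurable_fun setT (fun u : R => L u).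
  by apply: measurableT_comp => //; apply: measurable_funD.
(* On the half-line the density is rewritten as a power with exponent [-1], so that measurability
   follows from that of [powR]. *)
apply: (@eq_measurable_fun _ _ _ _ _
  (fun u => (pi * (L u) `^ 2^-1 * (1 + u) * (1 + L u)) `^ (- 1))).
  move=> u; rewrite inE/= in_itv/= andbT => u0.
  rewrite powR12_sqrt ?ltW ?ln1D_gt0// powR_inv1 ?ltW ?H_pdf_den_gt0//.
  by rewrite H_pdfE.
apply: measurable_funTS.
apply: (measurableT_comp (measurable_powR (- 1))).
apply: measurable_funM; last exact: measurable_funD.
apply: measurable_funM; last exact: measurable_funD.
by apply: measurable_funM => //; exact: measurableT_comp (measurable_powR _) mL.
Qed.

Lemma ln1D_ge_half u : 1 <= u -> 2^-1 <= L u.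
Proof.
move=> u1; rewrite -[leLHS]expRK ler_ln ?posrE ?expR_gt0//; last lra.
have := expR_ge1Dx (- 2^-1 : R); rewrite expRN => h.
have e0 := expR_gt0 (2^-1 : R).
have : expR (2^-1 : R) <= 2.
  have : (1 - 2^-1) * expR (2^-1 : R) <= 1.
    by rewrite -[leRHS](@mulVf _ (expR 2^-1)) ?gt_eqF// ler_wpM2r// ltW.
  by lra.
lra.
Qed.

Lemma ln1D_lbound u : 0 < u <= 1 -> u / 2 <= L u.
Proof.
move=> /andP[u0 u1].
have h : ln ((1 + u)^-1) <= (1 + u)^-1 - 1.
  have -> : (1 + u)^-1 = 1 + ((1 + u)^-1 - 1) by ring.
  rewrite [leRHS](_ : _ = (1 + u)^-1 - 1); last by ring.
  by apply: le_ln1Dx; rewrite ltrBrDl addrN invr_gt0; lra.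
rewrite lnV ?posrE in h; last lra.
have : u / 2 <= 1 - (1 + u)^-1.
  rewrite [leRHS](_ : _ = u / (1 + u)); last by field; lra.
  by rewrite ler_pM2l// lef_pV2 ?posrE; lra.
lra.
Qed.

(** For [u >= 1] the weight has the order of the logarithmic factors in the denominator and cancels
    them. For [u < 1] the density behaves like [1 / sqrt u], and the remaining [sqrt u] tames
    [logw (ln u)]. *)
Lemma H_pdf_ubound u : 0 < u -> u * H u * logw (ln u) <= 64.
Proof.
move=> u0; rewrite H_pdfE// mulrAC ler_pdivrMr ?H_pdf_den_gt0//.
have p1 := pi_ge1; have l0 := ln1D_gt0 u0.
set s : R := Num.sqrt (L u); have s0 : 0 < s by rewrite sqrtr_gt0.
have s2 : s ^+ 2 = L u by rewrite sqr_sqrtr// ltW.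
have [u1|u1] := leP 1 u.
  have lnu : 0 <= ln u by exact: ln_ge0.
  have lh := ln1D_ge_half u1.
  have hs : Num.sqrt (1 + L u) <= 2 * s.
    by apply: sqrtr_le_sqr; rewrite ?exprMn ?s2; lra.
  have hw : logw (ln u) <= (1 + L u) * (2 * s).
    apply: (@le_trans _ _ (pow32 (1 + L u))); last by rewrite ler_wpM2l//; lra.
    rewrite /logw ger0_norm// le_pow32//; first lra.
    by rewrite lerD2l ler_ln ?posrE; lra.
  apply: (@le_trans _ _ (u * ((1 + L u) * (2 * s)))); first by rewrite ler_pM2l.
  have q0 : 0 < s * (1 + L u) by rewrite mulr_gt0//; lra.
  have -> : u * ((1 + L u) * (2 * s)) = (s * (1 + L u)) * (2 * u) by ring.
  have -> : 64 * (pi * s * (1 + u) * (1 + L u)) = (s * (1 + L u)) * (64 * pi * (1 + u)) by ring.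
  by rewrite ler_pM2l//; nra.
have lh : u / 2 <= L u by apply: ln1D_lbound; lra.
have su0 : 0 < Num.sqrt u by rewrite sqrtr_gt0.
have su2 : Num.sqrt u ^+ 2 = u by rewrite sqr_sqrtr// ltW.
have hs : Num.sqrt u <= 2 * s.
  by apply: sqrtr_le_sqr; rewrite ?exprMn ?s2; lra.
have hw := logw_ln_sqrt u0.
apply: (@le_trans _ _ (Num.sqrt u * (16 * (1 + u)))).
  by rewrite -{1}su2 expr2 -mulrA ler_pM2l// mulrC.
apply: (@le_trans _ _ (2 * s * (16 * (1 + u)))); first by rewrite ler_wpM2r//; lra.
have -> : 64 * (pi * s * (1 + u) * (1 + L u)) = 
    (2 * s * (16 * (1 + u))) * (2 * pi * (1 + L u)) by ring.
rewrite ler_peMr//; last by nra.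
by rewrite !mulr_ge0//; lra.
Qed.

(** Converse of [H_pdf_ubound] in the tail, needed because outlier likelihoods are divided by [H y].
    The 4 comes from [(1 + y) / 2 <= y] and [(1 + ln (1 + y)) / 2 <= 1 + ln y]. *)
Lemma H_pdf_tail_lbound y : 1 <= y -> (4 * pi)^-1 <= y * H y * logw (ln y).
Proof.
move=> y1; have y0 : 0 < y by lra.
rewrite H_pdfE// mulrAC ler_pdivlMr ?H_pdf_den_gt0//.
have p0 := pi_gt0 R; have l0 := ln1D_gt0 y0.
have lny : 0 <= ln y by exact: ln_ge0.
have hl : L y <= 1 + ln y.
  apply: (@le_trans _ _ (ln (2 * y))); first by rewrite ler_ln ?posrE; lra.
  rewrite lnM ?posrE// lerD2r.
  by have := @le_ln1Dx R 1 ltac:(lra); rewrite (_ : 1 + 1 = 2 :> R).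
set s : R := Num.sqrt (L y); have s0 : 0 < s by rewrite sqrtr_gt0.
have hs : s <= Num.sqrt (1 + ln y) by rewrite ler_wsqrtr.
have -> : (4 * pi)^-1 * (pi * s * (1 + y) * (1 + L y)) =
  s * ((1 + y) / 2) * ((1 + L y) / 2).
  by move: p0; move: (pi : R) => P p0; field; rewrite gt_eqF.
rewrite /logw /pow32 ger0_norm//.
rewrite [leRHS](_ : _ = Num.sqrt (1 + ln y) * y * (1 + ln y)); last by ring.
apply: ler_pM; [by rewrite !mulr_ge0//; lra|lra| |lra].
by apply: ler_pM; [lra|lra| |lra].
Qed.

Lemma cvg_near1 (f g : R -> R) (M : R) : g y @[y --> +oo] --> +oo ->
  (\forall y \near +oo, `|f y - 1| * g y <= M) -> f y @[y --> +oo] --> (1 : R).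
Proof.
move=> gy fM; apply/cvgrPdist_le => e e0.
near=> y.
have h1 : 1 + `|M| / e <= g y.
  by near: y; move/cvgryPge : gy; apply.
have h2 : `|f y - 1| * g y <= M by near: y.
have Me : 0 <= `|M| / e by rewrite divr_ge0// ltW.
rewrite distrC -(@ler_pM2r _ (g y)); last lra.
apply: (le_trans h2); apply: (le_trans (ler_norm M)).
apply: (@le_trans _ _ (e * (`|M| / e))); first by rewrite mulrC divfK// gt_eqF.
by rewrite ler_pM2l//; lra.
Unshelve. all: by end_near. Qed.

Lemma cvgy_ln1D : (L y : R) @[y --> +oo] --> +oo.
Proof.
apply/cvgryPge => A; near=> y.
have : expR A <= 1 + y.
  by rewrite -lerBlDl; near: y; exact: nbhs_pinfty_ge (num_real _).
rewrite -ler_ln ?posrE ?expR_gt0// ?expRK//.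
have : 0 < y by near: y; exact: nbhs_pinfty_gt (num_real _).
lra.
Unshelve. all: by end_near. Qed.

(** Scaling the argument by [c] moves [ln (1 + y)] by at most [|ln c|], so all logarithmic ratios
    tend to 1; only [(1 + c * y) / (1 + y)] contributes, and tends to [c]. *)
Lemma H_pdf_slow c : 0 < c -> H (c * y) / H y @[y --> +oo] --> c^-1.
Proof.
move=> c0.
pose M := `|ln c|.
have dL y : 0 < y -> `|L (c * y) - L y| <= M.
  move=> y0; have cy0 : 0 < c * y by rewrite mulr_gt0.
  have [c1|c1] := leP 1 c.
    rewrite /M ger0_norm ?subr_ge0 ?le_ln1D//; last by nra.
    rewrite ger0_norm ?ln_ge0// lerBlDl addrC -lnM ?posrE//; last lra.
    by rewrite ler_ln ?posrE; nra.
  rewrite /M distrC ger0_norm ?subr_ge0 ?le_ln1D//; last by nra.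
  rewrite ltr0_norm ?ln_lt0 ?c0// lerBlDl -lerBlDr opprK addrC -lnM ?posrE//; last lra.
  by rewrite ler_ln ?posrE; nra.
have cA : L (c * y) / L y @[y --> +oo] --> (1 : R).
  apply: (@cvg_near1 _ _ M cvgy_ln1D); near=> y.
  have y0 : 0 < y by near: y; exact: nbhs_pinfty_gt (num_real _).
  have l0 := ln1D_gt0 y0.
  rewrite -[X in _ * X]gtr0_norm// -normrM mulrBl mul1r divfK ?gt_eqF//.
  exact: dL.
have cB : (1 + L (c * y)) / (1 + L y) @[y --> +oo] --> (1 : R).
  apply: (@cvg_near1 _ _ M cvgy_ln1D); near=> y.
  have y0 : 0 < y by near: y; exact: nbhs_pinfty_gt (num_real _).
  have l0 := ln1D_gt0 y0; have l1 : 0 < 1 + L y by lra.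
  apply: (@le_trans _ _ (`|(1 + L (c * y)) / (1 + L y) - 1| * (1 + L y))).
    by rewrite ler_wpM2l//; lra.
  rewrite -[X in _ * X]gtr0_norm// -normrM mulrBl mul1r divfK ?gt_eqF//.
  by rewrite opprD addrACA subrr add0r; exact: dL.
have cD : (1 + c * y) / (c * (1 + y)) @[y --> +oo] --> (1 : R).
  apply: (@cvg_near1 _ id (`|1 - c| / c) (@cvg_id _ _)); near=> y.
  have y0 : 0 < y by near: y; exact: nbhs_pinfty_gt (num_real _).
  have -> : (1 + c * y) / (c * (1 + y)) - 1 = (1 - c) / (c * (1 + y)).
    by field; rewrite !gt_eqF//; lra.
  have cy : 0 < c * (1 + y) by rewrite mulr_gt0//; lra.
  rewrite normrM normfV (gtr0_norm cy) -mulrA ler_wpM2l//.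
  by rewrite mulrC ler_pdivrMr// mulrA mulVf ?gt_eqF// mul1r; lra.
have : (c * (Num.sqrt (L (c * y) / L y) * ((1 + L (c * y)) / (1 + L y)) *
   ((1 + c * y) / (c * (1 + y)))))^-1 @[y --> +oo] --> (c * (Num.sqrt 1 * 1 * 1))^-1.
  apply: cvgV; first by rewrite sqrtr1 !mulr1 gt_eqF.
  apply: cvgM; first exact: cvg_cst.
  apply: cvgM => //; apply: cvgM => //.
  by apply: continuous_cvg => //; exact: sqrt_continuous.
rewrite sqrtr1 !mulr1; apply: cvg_trans; apply: near_eq_cvg; near=> y.
have y0 : 0 < y by near: y; exact: nbhs_pinfty_gt (num_real _).
have cy0 : 0 < c * y by rewrite mulr_gt0.
have l0 := ln1D_gt0 y0; have lc0 := ln1D_gt0 cy0.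
rewrite !H_pdfE// sqrtrM ?ltW// sqrtrV ?ltW//.
have s0 : 0 < Num.sqrt (L y) by rewrite sqrtr_gt0.
have sc0 : 0 < Num.sqrt (L (c * y)) by rewrite sqrtr_gt0.
have := pi_gt0 R; move: (pi : R) => P p0.
field.
by rewrite !gt_eqF//; lra.
Unshelve. all: by end_near. Qed.

(** With [a >= 1] there is no singularity at 0, and the exponential beats every power at infinity.
    In the exponent [N + 4], [N] pays for [u^(a-1)], 3 for the lower bound of [H], and 1 for the
    extra [1 / (1 + u)] that makes this component negligible in the tail. *)
Lemma gamma_pdf_le_H_pdf a : 1 <= a ->
  exists2 C : R, 0 <= C & forall u, 0 < u -> gamma_pdf a a u <= C * (H u / (1 + u)).
Proof.
move=> a1; pose N := (Num.truncn a).+1.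
have [C0 C0p hC0] := @polyM_expRN_bounded R (N + 4) 1 ltr01.
have G0 : 0 <= GammaF a.
  rewrite /GammaF fine_ge0//; apply: integral_ge0 => t _.
  by rewrite lee_fin mulr_ge0 ?powR_ge0 ?expR_ge0.
have k0 : 0 <= a `^ a / GammaF a by rewrite divr_ge0 ?powR_ge0.
exists (a `^ a / GammaF a * C0 * pi); first by rewrite mulr_ge0 ?pi_ge0// mulr_ge0// ltW.
move=> u u0.
have pu : u `^ (a - 1) <= (1 + u) ^+ N.
  apply: (@le_trans _ _ ((1 + u) `^ (a - 1))).
    by apply: ge0_ler_powR; rewrite ?nnegrE; lra.
  rewrite -powR_mulrn; last lra.
  apply: ler_powR; first lra.
  have : a < N%:R by exact: truncnS_gt.
  by lra.
have eu : expR (- (a * u)) <= expR (- (1 * u)).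
  by rewrite ler_expR lerN2 ler_wpM2r// ltW.
have h : u `^ (a - 1) * expR (- (a * u)) <= C0 / (1 + u) ^+ 4.
  rewrite ler_pdivlMr; last by rewrite exprn_gt0//; lra.
  apply: le_trans (hC0 u (ltW u0)); rewrite exprD mulrAC.
  apply: ler_pM => //; rewrite ?expR_ge0 ?mulr_ge0 ?powR_ge0 ?exprn_ge0//; try lra.
  by rewrite ler_wpM2r// exprn_ge0//; lra.
rewrite /gamma_pdf.
have -> : a `^ a * u `^ (a - 1) * expR (- (a * u)) / GammaF a =
  a `^ a / GammaF a * (u `^ (a - 1) * expR (- (a * u))) by ring.
rewrite [leRHS](_ : _ = a `^ a / GammaF a * (C0 * (pi * (H u / (1 + u))))); last first.
  by rewrite !mulrA.
rewrite ler_wpM2l//.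
apply: (le_trans h); rewrite ler_wpM2l ?(ltW C0p)//.
have H3 := H_pdf_lbound3 u0.
have u1 : 0 < 1 + u by lra.
rewrite mulrA ler_pdivlMr//.
have p0 := pi_gt0 R.
apply: (@le_trans _ _ (pi * (pi * (1 + u) ^+ 3)^-1)); last by rewrite ler_pM2l.
by move: p0; move: (pi : R) => P p0; rewrite le_eqVlt; apply/orP; left; apply/eqP;
  field; rewrite !gt_eqF.
Qed.

End H_pdf.

(** * Poisson weights on the half-line *)

Section halfline_integrals.
Context {R : realType}.
Implicit Types (mu t u v w x y z : R) (k : nat).
Local Notation H := (@H_pdf R).
Local Notation L u := (ln (1 + u)).
Local Notation leb := (@lebesgue_measure R).
Local Notation D0 := (`]0%R, +oo[%classic : set R).

Lemma set_itv0y u : D0 u -> 0 < u.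
Proof. by rewrite /= in_itv/= andbT. Qed.

Lemma poisson_pmfE mu u k : 0 < mu -> 0 < u ->
  poisson_pmf (u * mu) k = (u * mu) ^+ k / k`!%:R * expR (- (u * mu)).
Proof. by move=> mu0 u0; rewrite /poisson_pmf mulr_gt0. Qed.

Lemma measurable_poisson_pmf_scale mu k (D : set R) :
  measurable_fun D (fun u => poisson_pmf (u * mu) k).
Proof.
apply: measurable_funTS.
apply: (measurableT_comp (measurable_poisson_pmf k measurableT)).
exact: measurable_funM.
Qed.

(** The Poisson weight without the sign test on the rate: smooth on the whole line, hence usable at
    the endpoint 0 of the fundamental theorem of calculus. *)
Definition poisson_scaled mu k u : R := (u * mu) ^+ k / k`!%:R * expR (- (u * mu)).
Local Notation E := poisson_scaled.

Lemma is_derive_poisson_scaled mu k x : is_derive x (1 : R) (E mu k)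
  (mu * (if k is k'.+1 then E mu k' x - E mu k x else - E mu 0 x)).
Proof.
have dm : is_derive x (1 : R) ( *%R ^~ mu) mu.
  have := is_deriveZ mu (is_derive_id x (1 : R)).
  by rewrite (_ : mu \*: id = *%R ^~ mu) ?scaler1//; apply/funext => z; rewrite /= mulrC.
have de : is_derive x (1 : R) (fun u => expR (- (u * mu))) (- mu * expR (- (x * mu))).
  have dn := is_deriveN dm.
  have := @is_derive1_comp R expR (- ( *%R ^~ mu)) x _ _ (is_derive_expR _) dn.
  by move/is_derive_eq; apply; rewrite mulrC.
have dX := is_deriveX k dm.
have dXc := is_deriveZ (k`!%:R^-1 : R) dX.
have := is_deriveM dXc de.
rewrite (_ : _ * _ = E mu k); last first.
  by apply/funext => z; rewrite /poisson_scaled !fctE/= /GRing.scale/=; ring.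
move/is_derive_eq; apply.
rewrite !fctE /GRing.scale/= /GRing.scale/=; case: k dX dXc => [|k] dX dXc /=.
  by rewrite /poisson_scaled fact0 expr0; field.
rewrite /poisson_scaled factS natrM !exprS; field.
by rewrite !gt_eqF ?ltr0n ?fact_gt0.
Qed.

(** The derivatives [mu * (E (k-1) - E k)] telescope, which makes the Poisson distribution function
    a primitive of a single weight, up to the factor [- mu^-1]. *)
Lemma is_derive_sum_poisson_scaled mu k x : is_derive x (1 : R)
  (fun u => \sum_(j < k.+1) E mu j u) (- (mu * E mu k x)).
Proof.
elim: k => [|k IH].
  rewrite (_ : (fun _ => _) = E mu 0); last by apply/funext => u; rewrite big_ord1.
  by apply: (is_derive_eq (is_derive_poisson_scaled mu 0 x)); rewrite mulrN.
rewrite (_ : (fun _ => _) = (fun u => \sum_(j < k.+1) E mu j u) + E mu k.+1); last first.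
  by apply/funext => u; rewrite big_ord_recr.
by apply: (is_derive_eq (is_deriveD IH (is_derive_poisson_scaled mu k.+1 x))); ring.
Qed.

Lemma poisson_scaled_cvg0 mu k : 0 < mu -> E mu k u @[u --> +oo] --> (0 : R).
Proof.
move=> mu0; have [C C0 hC] := @polyM_expRN_bounded R k.+1 1 ltr01.
apply/cvgrPdist_le => e e0; near=> u.
have u0 : 0 < u by near: u; exact: nbhs_pinfty_gt (num_real _).
have um : 0 < u * mu by rewrite mulr_gt0.
rewrite sub0r normrN ger0_norm; last first.
  by rewrite !mulr_ge0 ?invr_ge0 ?expR_ge0 ?exprn_ge0// ltW.
have h1 : C / e / mu <= u by near: u; exact: nbhs_pinfty_ge (num_real _).
rewrite ler_pdivrMr// ler_pdivrMr// in h1.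
have h2 := hC (u * mu) (ltW um); rewrite mul1r exprS in h2.
have f1 : (1 : R) <= k`!%:R by rewrite ler1n fact_gt0.
have h3 : E mu k u <= (1 + u * mu) ^+ k * expR (- (u * mu)).
  rewrite /poisson_scaled ler_wpM2r ?expR_ge0//.
  apply: (@le_trans _ _ ((u * mu) ^+ k)).
    by rewrite ler_pdivrMr ?ltr0n ?fact_gt0// ler_peMr// exprn_ge0// ltW.
  by rewrite lerXn2r ?nnegrE//; lra.
rewrite -(@ler_pM2l _ (u * mu))//.
apply: (le_trans _ h1); apply: (le_trans _ h2).
rewrite -mulrA; apply: ler_pM => //; last lra.
- by lra.
- by rewrite !mulr_ge0 ?invr_ge0 ?expR_ge0 ?exprn_ge0// ltW.
Unshelve. all: by end_near. Qed.

Lemma sum_poisson_scaled_cvg0 mu k : 0 < mu ->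
  \sum_(j < k.+1) E mu j u @[u --> +oo] --> (0 : R).
Proof.
move=> mu0; elim: k => [|k IH].
  rewrite (_ : (fun _ => _) = E mu 0); first exact: poisson_scaled_cvg0.
  by apply/funext => u; rewrite big_ord1.
have : \sum_(j < k.+1) E mu j u + E mu k.+1 u @[u --> +oo] --> (0 + 0 : R).
  by apply: cvgD => //; exact: poisson_scaled_cvg0.
rewrite addr0; apply: cvg_trans; apply: near_eq_cvg; near=> u.
by rewrite [RHS]big_ord_recr.
Unshelve. all: by end_near. Qed.

(** The normalization of a Gamma density. Its independence of [k] is what reduces the integral of a
    combination of weights to the sum of its coefficients. *)
Lemma integral_poisson_pmf mu k : 0 < mu ->
  (\int[leb]_(u in D0) (poisson_pmf (u * mu) k)%:E = (mu^-1)%:E)%E.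
Proof.
move=> mu0.
transitivity (\int[leb]_(u in D0) (E mu k u)%:E)%E.
  by apply: eq_integral => u /[1!inE] /set_itv0y u0; rewrite poisson_pmfE.
have cE : continuous (E mu k).
  by move=> x; apply/differentiable_continuous/derivable1_diffP; case: (is_derive_poisson_scaled mu k x).
have mE : measurable_fun setT (E mu k) by exact: continuous_measurable_fun.
rewrite integral_itv_obnd_cbnd; last by apply/measurable_EFinP; exact: measurable_funTS.
pose F u : R := - (mu^-1 * \sum_(j < k.+1) E mu j u).
have dF x : is_derive x (1 : R) F (E mu k x).
  have := is_deriveN (is_deriveZ mu^-1 (is_derive_sum_poisson_scaled mu k x)).
  by move/is_derive_eq; apply; rewrite /GRing.scale/= mulrN opprK mulrA mulVf ?gt_eqF ?mul1r.
have cF : continuous F.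
  by move=> x; apply/differentiable_continuous/derivable1_diffP; case: (dF x).
rewrite (@ge0_continuous_FTC2y _ _ F _ 0)//.
- rewrite /F big_ord_recl big1 ?addr0; last first.
    by move=> i _; rewrite /poisson_scaled mul0r exprS mul0r !mul0r.
  by rewrite /poisson_scaled mul0r expr0 fact0 oppr0 expR0 divr1 !mulr1 EFinN oppeK add0e.
- move=> x x0; rewrite /poisson_scaled !mulr_ge0 ?invr_ge0 ?expR_ge0 ?exprn_ge0//.
  by rewrite mulr_ge0// ltW.
- exact: continuous_subspaceT.
- have : F u @[u --> +oo] --> - (mu^-1 * 0).
    by apply: cvgN; apply: cvgM; [exact: cvg_cst|exact: sum_poisson_scaled_cvg0].
  by rewrite mulr0 oppr0.
- by apply: cvg_at_right_filter; exact: cF.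
- by move=> x _; rewrite derive1E; case: (dF x).
Qed.

Lemma integrable_poisson_pmf mu k : 0 < mu ->
  leb.-integrable D0 (fun u => (poisson_pmf (u * mu) k)%:E).
Proof.
move=> mu0; apply/integrableP; split.
  by apply/measurable_EFinP; exact: measurable_poisson_pmf_scale.
under eq_integral do rewrite gee0_abs ?lee_fin ?poisson_pmf_ge0//.
by rewrite integral_poisson_pmf// ltry.
Qed.

Lemma integrable_scaled_poisson_pmf mu k c : 0 < mu ->
  leb.-integrable D0 (fun u => (c * poisson_pmf (u * mu) k)%:E).
Proof.
move=> mu0; rewrite (_ : (fun _ => _) = (fun u => c%:E * (poisson_pmf (u * mu) k)%:E)%E)//.
by apply: integrableZl; [exact: measurable_itv|exact: integrable_poisson_pmf].
Qed.

Lemma integrable_sum_poisson_pmf mu k N (c : nat -> R) : 0 < mu ->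
  leb.-integrable D0 (fun u => (\sum_(j < N) c j * poisson_pmf (u * mu) (k + j))%:E).
Proof.
move=> mu0; rewrite (_ : (fun _ => _) =
    (fun u => \sum_(j < N) (c j * poisson_pmf (u * mu) (k + j))%:E)%E); last first.
  by apply/funext => u; rewrite sumEFin.
apply: integrable_sum; first exact: measurable_itv.
by move=> j _; exact: integrable_scaled_poisson_pmf.
Qed.

Lemma integral_sum_poisson_pmf mu k N (c : nat -> R) : 0 < mu ->
  (\int[leb]_(u in D0) (\sum_(j < N) c j * poisson_pmf (u * mu) (k + j))%:E =
   ((\sum_(j < N) c j) / mu)%:E)%E.
Proof.
move=> mu0; have mD : measurable D0 by exact: measurable_itv.
under eq_integral do rewrite -sumEFin.
rewrite integral_sum//; last by move=> j; exact: integrable_scaled_poisson_pmf.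
rewrite mulr_suml -sumEFin; apply: eq_bigr => j _.
under eq_integral do rewrite EFinM.
by rewrite integralZl ?integral_poisson_pmf//; exact: integrable_poisson_pmf.
Qed.

(** The substitution [v = sqrt (ln (1 + u * mu))] turns the heavy-tailed density into a half-Cauchy
    one, hence the arctangent. *)
Definition H_cdf mu u : R := 2 / (pi * mu) * atan (Num.sqrt (L (u * mu))).

Lemma is_derive_H_cdf mu x : 0 < mu -> 0 < x -> is_derive x (1 : R) (H_cdf mu) (H (x * mu)).
Proof.
move=> mu0 x0; have xm : 0 < x * mu by rewrite mulr_gt0.
have l0 := ln1D_gt0 xm.
have dm : is_derive x (1 : R) (cst 1 + *%R ^~ mu) mu.
  have := is_deriveD (is_derive_cst (1 : R) x (1 : R)) (is_deriveZ mu (is_derive_id x (1 : R))).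
  rewrite (_ : mu \*: id = *%R ^~ mu); last by apply/funext => z; rewrite /= mulrC.
  by rewrite add0r scaler1.
have dl := @is_derive1_comp R (@ln R) (cst 1 + *%R ^~ mu) x _ _ (is_derive1_ln (ltr_wpDr (ltW xm) ltr01)) dm.
have ds := @is_derive1_comp R Num.sqrt _ x _ _ (is_derive1_sqrt l0) dl.
have da := @is_derive1_comp R (@atan R) _ x _ _ (is_derive1_atan _) ds.
have := is_deriveZ (2 / (pi * mu)) da.
move/is_derive_eq; apply.
rewrite H_pdfE// /GRing.scale/= sqr_sqrtr ?ltW//.
have s0 : 0 < Num.sqrt (L (x * mu)) by rewrite sqrtr_gt0.
have := pi_gt0 R; move: (pi : R) => P p0.
by field; rewrite !gt_eqF//; lra.
Qed.

Lemma cvg_H_cdf mu : 0 < mu -> H_cdf mu u @[u --> +oo] --> mu^-1.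
Proof.
move=> mu0.
have -> : mu^-1 = 2 / (pi * mu) * (pi / 2) :> R.
  by have := pi_gt0 R; move: (pi : R) => P p0; field; rewrite !gt_eqF.
apply: cvgM; first exact: cvg_cst.
apply: (@cvg_comp _ _ _ (fun u => Num.sqrt (L (u * mu))) (@atan R) _ (pinfty_nbhs R));
  last exact: cvgy_atan.
apply/cvgryPge => A; near=> u.
have um : expR (A ^+ 2) <= u * mu.
  by rewrite -ler_pdivrMr//; near: u; exact: nbhs_pinfty_ge (num_real _).
have hL : A ^+ 2 <= L (u * mu).
  rewrite -[leLHS]expRK ler_ln ?posrE ?expR_gt0//; first lra.
  by have := expR_gt0 (A ^+ 2); lra.
apply: (@le_trans _ _ `|A|); first exact: ler_norm.
by rewrite -sqrtr_sqr ler_wsqrtr.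
Unshelve. all: by end_near. Qed.

Lemma continuous_H_pdf_scale mu x : 0 < mu -> 0 < x -> {for x, continuous (fun u => H (u * mu))}.
Proof.
move=> mu0 x0; have xm : 0 < x * mu by rewrite mulr_gt0.
have cm : (1 + u * mu) @[u --> x] --> 1 + x * mu.
  by apply: cvgD; [exact: cvg_cst|apply: cvgM; [exact: cvg_id|exact: cvg_cst]].
have cl : L (u * mu) @[u --> x] --> L (x * mu).
  by apply: continuous_cvg => //; apply: continuous_ln; lra.
have cs : Num.sqrt (L (u * mu)) @[u --> x] --> Num.sqrt (L (x * mu)).
  by apply: continuous_cvg => //; exact: sqrt_continuous.
rewrite /prop_for /continuous_at H_pdfE//.
have : (pi * Num.sqrt (L (u * mu)) * (1 + u * mu) * (1 + L (u * mu)))^-1 @[u --> x] -->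
    (pi * Num.sqrt (L (x * mu)) * (1 + x * mu) * (1 + L (x * mu)))^-1.
  apply: cvgV; first by rewrite gt_eqF// H_pdf_den_gt0.
  apply: cvgM; last by apply: cvgD => //; exact: cvg_cst.
  by apply: cvgM => //; apply: cvgM => //; exact: cvg_cst.
apply: cvg_trans; apply: near_eq_cvg; near=> u; rewrite H_pdfE// mulr_gt0//.
by near: u; exact: lt_nbhsr.
Unshelve. all: by end_near. Qed.

Lemma measurable_H_pdf_scale mu : 0 < mu -> measurable_fun D0 (fun u => H (u * mu)).
Proof.
move=> mu0; apply: open_continuous_measurable_fun; first exact: interval_open.
by move=> x /[1!inE] /set_itv0y x0; exact: continuous_H_pdf_scale.
Qed.

Lemma integral_H_pdf_scale_le mu : 0 < mu ->
  (\int[leb]_(u in D0) (H (u * mu))%:E <= (mu^-1)%:E)%E.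
Proof.
move=> mu0.
(* The density is singular at 0, so the primitive is used on intervals bounded away from 0, followed
   by monotone convergence; dropping its nonnegative value at the lower endpoint gives the
   inequality. *)
pose D k := (`[k.+1%:R^-1, +oo[%classic : set R).
have UD : D0 = \bigcup_k D k.
  apply/seteqP; split => x /=.
    rewrite in_itv/= andbT => x0; exists (Num.truncn x^-1) => //=.
    rewrite /D/= in_itv/= andbT -[leRHS]invrK lef_pV2 ?posrE ?invr_gt0 ?ltr0n//.
    by apply/ltW; exact: truncnS_gt.
  by move=> [k _]; rewrite /D/= !in_itv/= !andbT; apply: lt_le_trans; rewrite invr_gt0 ltr0n.
have DD k x : D k x -> D0 x by move=> Dk; rewrite UD; exists k.
have mH := measurable_H_pdf_scale mu0.
have H0 x : D0 x -> (0 <= (H (x * mu))%:E)%E.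
  by move=> /set_itv0y x0; rewrite lee_fin H_pdf_ge0// mulr_ge0 ?ltW.
have cvgI : (\int[leb]_(u in D k) (H (u * mu))%:E @[k --> \oo] -->
    \int[leb]_(u in \bigcup_k D k) (H (u * mu))%:E)%E.
  apply: ge0_nondecreasing_set_cvg_integral.
  - apply/nondecreasing_seqP => k; apply/subsetPset => x.
    rewrite /D/= !in_itv/= !andbT; apply: le_trans.
    by rewrite lef_pV2 ?posrE ?ltr0n// ler_nat.
  - by move=> k; exact: measurable_itv.
  - move=> k; apply/measurable_EFinP; apply: measurable_funS mH; first exact: measurable_itv.
    by move=> x; exact: DD.
  - by move=> k x /DD; exact: H0.
rewrite UD; apply: (cvge_to_le cvgI); near=> k.
have r0 : 0 < k.+1%:R^-1 :> R by rewrite invr_gt0 ltr0n.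
have gt0 x : k.+1%:R^-1 <= x -> 0 < x by exact: lt_le_trans.
have cF x : 0 < x -> {for x, continuous (H_cdf mu)}.
  move=> x0; apply/differentiable_continuous/derivable1_diffP.
  by case: (is_derive_H_cdf mu0 x0).
rewrite (@ge0_continuous_FTC2y _ _ (H_cdf mu) _ mu^-1).
- rewrite -EFinB lee_fin gerBl /H_cdf mulr_ge0//.
    by rewrite divr_ge0// mulr_ge0 ?pi_ge0// ltW.
  by rewrite -atan0 le_atan// sqrtr_ge0.
- by move=> x /gt0 x0; rewrite H_pdf_ge0// mulr_ge0// ltW.
- apply: continuous_in_subspaceT => x; rewrite inE/= in_itv/= andbT => /gt0 x0.
  exact: continuous_H_pdf_scale.
- exact: cvg_H_cdf.
- by move=> x /(lt_trans r0) x0; case: (is_derive_H_cdf mu0 x0).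
- by apply: cvg_at_right_filter; exact: cF.
- move=> x; rewrite in_itv/= andbT => /(lt_trans r0) x0.
  by rewrite derive1E; case: (is_derive_H_cdf mu0 x0).
Unshelve. all: by end_near. Qed.

End halfline_integrals.

(** * Marginal likelihood: bounds *)

Section marginal_likelihood.
Context {R : realType}.
Implicit Types (mu t u v w x y z th e A B C : R) (k : nat).
Local Notation H := (@H_pdf R).
Local Notation leb := (@lebesgue_measure R).
Local Notation D0 := (`]0%R, +oo[%classic : set R).
Variables (s a : R).
Hypotheses (s01 : 0 < s < 1) (a1 : 1 <= a).
Local Notation f := (mix_pdf s a).
Local Notation marg := (marg_lik s a).

Lemma gamma_pdf_ge0 u : 0 <= gamma_pdf a a u.
Proof.
rewrite /gamma_pdf divr_ge0 ?mulr_ge0 ?powR_ge0 ?expR_ge0//.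
rewrite /GammaF fine_ge0//; apply: integral_ge0 => t _.
by rewrite lee_fin mulr_ge0 ?powR_ge0 ?expR_ge0.
Qed.

Lemma mix_pdf_lbound u : s * H u <= f u.
Proof.
have /andP[s0 s1] := s01.
by rewrite /mix_pdf lerDr mulr_ge0 ?gamma_pdf_ge0//; lra.
Qed.

Lemma mix_pdf_ge0 u : 0 < u -> 0 <= f u.
Proof.
move=> u0; apply: le_trans (mix_pdf_lbound u); have /andP[s0 s1] := s01.
by rewrite mulr_ge0 ?ltW// H_pdf_gt0.
Qed.

(** The coefficient of [H u] is kept equal to [s], since it becomes the limit in [marg_lik_tail]. *)
Lemma mix_pdf_ubound : exists2 C, 0 < C &
  forall u, 0 < u -> f u <= s * H u + C * (H u / (1 + u)).
Proof.
have [C C0 hC] := gamma_pdf_le_H_pdf a1; have /andP[s0 s1] := s01.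
exists (C + 1); first lra.
move=> u u0; rewrite /mix_pdf addrC lerD2l.
have h0 : 0 <= H u / (1 + u) by rewrite divr_ge0 ?ltW ?H_pdf_gt0//; lra.
apply: (@le_trans _ _ (C * (H u / (1 + u)))); last by rewrite ler_wpM2r//; lra.
apply: le_trans (hC u u0); rewrite ler_piMl ?gamma_pdf_ge0//; lra.
Qed.

Lemma mix_pdf_le_H_pdf : exists2 C, 0 < C & forall u, 0 < u -> f u <= C * H u.
Proof.
have [C C0 hC] := mix_pdf_ubound; have /andP[s0 s1] := s01.
exists (s + C); first lra.
move=> u u0; apply: (le_trans (hC u u0)).
have h0 := H_pdf_gt0 u0.
rewrite mulrDl lerD2l ler_pM2l// ler_pdivrMr; last lra.
by rewrite ler_peMr//; lra.
Qed.

Lemma mix_pdf_logw_bounded : exists2 C, 0 < C &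
  forall u, 0 < u -> f u * (u * logw (ln u)) <= C.
Proof.
have [C C0 hC] := mix_pdf_le_H_pdf; exists (64 * C); first by rewrite mulr_gt0.
move=> u u0; have w0 := logw_gt0 (ln u).
apply: (@le_trans _ _ (C * H u * (u * logw (ln u)))).
  by rewrite ler_wpM2r ?hC// ltW// mulr_gt0.
have -> : C * H u * (u * logw (ln u)) = C * (u * H u * logw (ln u)) by ring.
by rewrite [leRHS]mulrC ler_pM2l// H_pdf_ubound.
Qed.

Lemma measurable_mix_pdf : measurable_fun D0 f.
Proof.
apply: measurable_funD; apply: measurable_funM => //; last exact: measurable_H_pdf.
apply: measurable_funTS.
apply: measurable_funM => //; apply: measurable_funM.
  by apply: measurable_funM => //; exact: measurable_powR.
by apply: measurableT_comp => //; apply: measurableT_comp => //; exact: measurable_funM.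
Qed.

Lemma measurable_mix_poisson mu k :
  measurable_fun D0 (fun u => f u * poisson_pmf (u * mu) k).
Proof.
apply: measurable_funM; first exact: measurable_mix_pdf.
exact: measurable_poisson_pmf_scale.
Qed.

Lemma poisson_pmf_le1 mu u k : 0 < mu -> 0 < u -> poisson_pmf (u * mu) k <= 1.
Proof.
move=> mu0 u0; rewrite poisson_pmfE//.
rewrite expRN ler_pdivrMr ?expR_gt0// mul1r ler_pdivrMr ?ltr0n ?fact_gt0//.
by rewrite [leRHS]mulrC; apply: expr_le_expR; rewrite mulr_ge0// ltW.
Qed.

(** The Poisson weight is at most 1. This crude bound also serves the zero counts, whose likelihood
    does not decay as the rate tends to 0. *)
Lemma integral_mix_poisson_bounded : exists2 C, 0 < C & forall k mu, 0 < mu ->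
  (\int[leb]_(u in D0) (f u * poisson_pmf (u * mu) k)%:E <= C%:E)%E.
Proof.
have [C C0 hC] := mix_pdf_le_H_pdf; exists C => // k mu mu0.
have H1 := @integral_H_pdf_scale_le R 1 ltr01.
apply: (@le_trans _ _ (\int[leb]_(u in D0) (C%:E * (H (u * 1))%:E))%E).
  apply: ge0_le_integral => //.
  - move=> u /set_itv0y u0; rewrite lee_fin mulr_ge0 ?mix_pdf_ge0//.
    exact: poisson_pmf_ge0.
  - by apply/measurable_EFinP; exact: measurable_mix_poisson.
  - by apply/measurable_EFinP; apply: measurable_funM => //; exact: measurable_H_pdf_scale.
  - move=> u /set_itv0y u0; rewrite mulr1 -EFinM lee_fin.
    apply: (@le_trans _ _ (f u)); last exact: hC.
    by rewrite ler_piMr ?mix_pdf_ge0// poisson_pmf_le1.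
rewrite ge0_integralZl_EFin//.
- by rewrite -[X in (_ <= X)%E]mule1 lee_pmul2l//; rewrite invr1 in H1.
- by move=> u /set_itv0y u0; rewrite lee_fin H_pdf_ge0// mulr1 ltW.
- by apply/measurable_EFinP; exact: measurable_H_pdf_scale.
- exact: ltW.
Qed.

Lemma integrable_mix_poisson mu k : 0 < mu ->
  leb.-integrable D0 (fun u => (f u * poisson_pmf (u * mu) k)%:E).
Proof.
move=> mu0; apply/integrableP; split.
  by apply/measurable_EFinP; exact: measurable_mix_poisson.
have [C C0 hC] := integral_mix_poisson_bounded.
apply: (@le_lt_trans _ _ C%:E); last exact: ltry.
apply: le_trans (hC k mu mu0); rewrite le_eqVlt; apply/orP; left; apply/eqP.
apply: eq_integral => u /[1!inE] /set_itv0y u0.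
by rewrite gee0_abs// lee_fin mulr_ge0 ?mix_pdf_ge0// poisson_pmf_ge0.
Qed.

Lemma marg_likE mu k : 0 < mu ->
  (\int[leb]_(u in D0) (f u * poisson_pmf (u * mu) k)%:E = (marg k mu)%:E)%E.
Proof.
move=> mu0; rewrite /marg_lik fineK//.
by apply: integrable_fin_num; [exact: measurable_itv|exact: integrable_mix_poisson].
Qed.

Lemma marg_lik_ge0 k mu : 0 <= marg k mu.
Proof.
rewrite /marg_lik fine_ge0//; apply: integral_ge0 => u /set_itv0y u0.
by rewrite lee_fin mulr_ge0 ?mix_pdf_ge0// poisson_pmf_ge0.
Qed.

Lemma marg_lik_bounded : exists2 C, 0 < C & forall k mu, 0 < mu -> marg k mu <= C.
Proof.
have [C C0 hC] := integral_mix_poisson_bounded; exists C => // k mu mu0.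
by rewrite -lee_fin -marg_likE//; exact: hC.
Qed.

Lemma marg_lik_gt0 k mu : 0 < mu -> 0 < marg k mu.
Proof.
move=> mu0; have /andP[s0 s1] := s01.
(* A lower bound of the integrand on [[1, 2]]: [H] is smallest at 2, the power of [u] at 1, and the
   exponential at 2. *)
pose c : R := s * H 2 * (mu ^+ k / k`!%:R * expR (- (2 * mu))).
have c0 : 0 < c.
  rewrite mulr_gt0//; first by rewrite mulr_gt0// H_pdf_gt0.
  by rewrite mulr_gt0 ?expR_gt0// divr_gt0 ?exprn_gt0// ltr0n fact_gt0.
have sub : (`[1%R, 2%R]%classic : set R) `<=` D0.
  by move=> u /=; rewrite !in_itv/= andbT => /andP[u1 _]; lra.
rewrite -lte_fin -marg_likE//.
have p0 u : D0 u -> (0 <= (f u * poisson_pmf (u * mu) k)%:E)%E.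
  by move=> /set_itv0y u0; rewrite lee_fin mulr_ge0 ?mix_pdf_ge0// poisson_pmf_ge0.
have mD : measurable D0 by exact: measurable_itv.
have mI : measurable (`[1%R, 2%R]%classic : set R) by exact: measurable_itv.
have mf : measurable_fun D0 (fun u => (f u * poisson_pmf (u * mu) k)%:E).
  by apply/measurable_EFinP; exact: measurable_mix_poisson.
apply: (@lt_le_trans _ _ (\int[leb]_(u in `[1%R, 2%R]%classic) c%:E)%E).
  rewrite integral_cst//.
  rewrite [X in (_ * X)%E](_ : _ = 1%E) ?mule1 ?lte_fin//.
  transitivity (leb (`[1%R, 2%R]%classic : set R)) => //.
  by rewrite lebesgue_measure_itv/= lte_fin ltr1n -EFinB; congr EFin; lra.
apply: (le_trans _ (@ge0_subset_integral _ _ _ leb _ _ mI mD _ mf p0 sub)).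
apply: ge0_le_integral => //.
- by move=> u _; rewrite lee_fin ltW.
- exact: measurable_funS mf.
- move=> u /=; rewrite in_itv/= => /andP[u1 u2]; rewrite lee_fin.
  have u0 : 0 < u by lra.
  apply: ler_pM.
  + by rewrite mulr_ge0 ?ltW ?H_pdf_gt0.
  + by rewrite !mulr_ge0 ?invr_ge0 ?exprn_ge0 ?expR_ge0// ltW.
  + apply: le_trans (mix_pdf_lbound u); rewrite ler_pM2l//; exact: H_pdf_nincr.
  + rewrite poisson_pmfE//; apply: ler_pM.
    * by rewrite divr_ge0// exprn_ge0// ltW.
    * exact: expR_ge0.
    * rewrite ler_wpM2r// lerXn2r ?nnegrE ?(ltW mu0)//.
        by rewrite mulr_ge0 ?(ltW mu0) ?(ltW u0).
      by rewrite ler_peMl ?(ltW mu0).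
    * by rewrite ler_expR lerN2 ler_wpM2r// ltW.
Qed.

Lemma measurable_marg_lik k : measurable_fun setT (marg k).
Proof.
(* Tonelli is applied on the whole plane, while the density is nonnegative and measurable on the
   half-line only; it is extended by 0. *)
have mfr : measurable_fun setT (f \_ D0).
  by apply/(measurable_restrictT f (measurable_itv _)); exact: measurable_mix_pdf.
have fr0 u : 0 <= (f \_ D0) u.
  by rewrite patchE; case: ifPn => // /[1!inE] /set_itv0y; exact: mix_pdf_ge0.
pose h (z : R * R) : \bar R := ((f \_ D0) z.2 * poisson_pmf (z.2 * z.1) k)%:E.
have mh : measurable_fun setT h.
  apply/measurable_EFinP; apply: measurable_funM; first exact: measurableT_comp.
  apply: (measurableT_comp (measurable_poisson_pmf k measurableT)).
  exact: measurable_funM.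
have h0 (z : R * R) : (0 <= h z)%E by rewrite lee_fin mulr_ge0 ?poisson_pmf_ge0.
have := @measurable_fun_fubini_tonelli_F _ _ _ _ _ leb h mh h0.
move=> mF.
rewrite (_ : marg k = fine \o fubini_F leb h); first exact: measurableT_comp.
apply/funext => mu; rewrite /marg_lik /= /fubini_F; congr fine.
rewrite [LHS]integral_mkcond; apply: eq_integral => u _.
by rewrite /h /= !patchE; case: ifPn => //; rewrite mul0r.
Qed.

(** Since [th = ln (u * mu) - ln u], the weight at [th] splits in two: one part is absorbed by the
    decay of the mixture density at [u], the other, with the Poisson weight, by [H (u * mu)]. A
    positive count supplies a factor [u * mu], whose [u] completes the first bound and whose [mu]
    cancels the integral of [H (u * mu)]. *)
Lemma marg_lik_decay k : (0 < k)%N -> exists2 C, 0 < C &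
  forall th, marg k (expR th) <= C / logw th.
Proof.
case: k => // k _.
have [C1 C10 hC1] := mix_pdf_logw_bounded.
(* In [k + 3], [k] comes from the Poisson weight once a factor [u * mu] is set apart, 2 from
   [H_pdf_lbound] and 1 from [logw_ln_sqrt]. *)
have [C2 C20 hC2] := @polyM_expRN_bounded R (k + 3) 1 ltr01.
have p0 := pi_gt0 R.
pose K : R := C1 * (16 * (pi * C2)).
have K0 : 0 < K by rewrite !mulr_gt0.
exists K => // th; set mu := expR th; have mu0 : 0 < mu by exact: expR_gt0.
have w0 := logw_gt0 th.
have bnd u : 0 < u -> f u * poisson_pmf (u * mu) k.+1 <= K / logw th * (mu * H (u * mu)).
  move=> u0; have v0 : 0 < u * mu by rewrite mulr_gt0.
  have lu0 := logw_gt0 (ln u); have lv0 := logw_gt0 (ln (u * mu)).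
  have h1 := hC1 u u0.
  have h2 : logw th <= logw (ln u) * logw (ln (u * mu)).
    rewrite lnM ?posrE// expRK mulrC -(logwN (ln u)).
    by apply: le_trans (logwD _ _); rewrite addrAC subrr add0r.
  have h3 : poisson_pmf (u * mu) k.+1 <= (u * mu) * ((1 + u * mu) ^+ k * expR (- (u * mu))).
    rewrite poisson_pmfE// mulrA ler_wpM2r ?expR_ge0//.
    have f1 : (1 : R) <= k.+1`!%:R by rewrite ler1n fact_gt0.
    apply: (@le_trans _ _ ((u * mu) ^+ k.+1)).
      by rewrite ler_pdivrMr ?ltr0n ?fact_gt0// ler_peMr// exprn_ge0// ltW.
    by rewrite exprS ler_pM2l// lerXn2r ?nnegrE; lra.
  have h4 : logw (ln (u * mu)) * ((1 + u * mu) ^+ k * expR (- (u * mu))) <=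
      16 * (pi * C2) * H (u * mu).
    set v := u * mu in v0 lv0 h2 h3 *.
    have sv0 : 0 < Num.sqrt v by rewrite sqrtr_gt0.
    have hH := H_pdf_lbound v0.
    have d0 : 0 < pi * Num.sqrt v * (1 + v) ^+ 2.
      by rewrite mulr_gt0 ?mulr_gt0 ?exprn_gt0//; lra.
    apply: (@le_trans _ _ (16 * (pi * C2) * (pi * Num.sqrt v * (1 + v) ^+ 2)^-1)); last first.
      by rewrite ler_pM2l// !mulr_gt0.
    rewrite ler_pdivlMr//.
    have h5 := hC2 v (ltW v0); rewrite mul1r in h5.
    have h6 := logw_ln_sqrt v0.
    apply: (@le_trans _ _ (16 * (pi * ((1 + v) ^+ (k + 3) * expR (- v))))); last first.
      by rewrite ler_pM2l// ler_pM2l.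
    have -> : logw (ln v) * ((1 + v) ^+ k * expR (- v)) * (pi * Num.sqrt v * (1 + v) ^+ 2) =
      (logw (ln v) * Num.sqrt v) * (pi * ((1 + v) ^+ k * (1 + v) ^+ 2 * expR (- v))) by ring.
    have -> : 16 * (pi * ((1 + v) ^+ (k + 3) * expR (- v))) =
      (16 * (1 + v)) * (pi * ((1 + v) ^+ k * (1 + v) ^+ 2 * expR (- v))).
      by rewrite exprD; ring.
    by rewrite ler_wpM2r// !mulr_ge0 ?expR_ge0 ?exprn_ge0//; lra.
  have f0 := mix_pdf_ge0 u0.
  have e0 : 0 <= (1 + u * mu) ^+ k * expR (- (u * mu)).
    by rewrite mulr_ge0 ?expR_ge0// exprn_ge0//; lra.
  rewrite mulrAC ler_pdivlMr//.
  apply: (@le_trans _ _ (f u * (u * mu * ((1 + u * mu) ^+ k * expR (- (u * mu)))) *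
     (logw (ln u) * logw (ln (u * mu))))).
    by rewrite ler_pM ?mulr_ge0 ?poisson_pmf_ge0 ?(ltW w0)// ler_wpM2l.
  have -> : f u * (u * mu * ((1 + u * mu) ^+ k * expR (- (u * mu)))) *
     (logw (ln u) * logw (ln (u * mu))) = (f u * (u * logw (ln u))) *
     (mu * (logw (ln (u * mu)) * ((1 + u * mu) ^+ k * expR (- (u * mu))))) by ring.
  have -> : K * (mu * H (u * mu)) = C1 * (mu * (16 * (pi * C2) * H (u * mu))).
    by rewrite /K; ring.
  apply: ler_pM => //.
  - by rewrite mulr_ge0// mulr_ge0 ?ltW.
  - by rewrite mulr_ge0 ?(ltW mu0)// mulr_ge0 ?(ltW lv0).
  - by rewrite ler_pM2l.
rewrite -lee_fin -marg_likE//.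
apply: (@le_trans _ _ (\int[leb]_(u in D0) ((K / logw th * mu)%:E * (H (u * mu))%:E))%E).
  apply: ge0_le_integral => //.
  - move=> u /set_itv0y u0; rewrite lee_fin mulr_ge0 ?mix_pdf_ge0//.
    exact: poisson_pmf_ge0.
  - by apply/measurable_EFinP; exact: measurable_mix_poisson.
  - by apply/measurable_EFinP; apply: measurable_funM => //; exact: measurable_H_pdf_scale.
  - by move=> u /set_itv0y u0; rewrite -EFinM lee_fin; have := bnd u u0; rewrite mulrA.
rewrite ge0_integralZl_EFin//.
- have := integral_H_pdf_scale_le mu0.
  have q0 : 0 < K / logw th * mu by rewrite mulr_gt0// divr_gt0.
  rewrite -(@lee_pmul2l _ (K / logw th * mu)%:E)// => /le_trans; apply.
  by rewrite -EFinM lee_fin mulfK ?gt_eqF.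
- by move=> u /set_itv0y u0; rewrite lee_fin H_pdf_ge0// mulr_ge0 ?ltW.
- by apply/measurable_EFinP; exact: measurable_H_pdf_scale.
- by rewrite mulr_ge0 ?(ltW mu0)// divr_ge0 ?ltW.
Qed.

End marginal_likelihood.

(** * Marginal likelihood: tail *)

Section marginal_tail.
Context {R : realType}.
Implicit Types (mu t u v w x y z th e A B C : R) (k : nat).
Local Notation H := (@H_pdf R).
Local Notation leb := (@lebesgue_measure R).
Local Notation D0 := (`]0%R, +oo[%classic : set R).

(* A weight that is small near [t = 1] and dominates [1 + t^-2] away from it, and
   whose Poisson-weighted integrals are explicit Gamma moments ([dev2_mean]). *)
Definition dev2 t : R := (t - 1) ^+ 2 * (1 + t ^- 2).

(** For [t <= 1/2], [(t - 1)^2 >= 1/4]; otherwise [t^-2 <= 4]. *)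
Lemma dev2_cover t : 0 < t -> 1 + t ^- 2 <= 5 + 4 * dev2 t.
Proof.
move=> t0; rewrite /dev2 -exprVn; have r0 : 0 < t^-1 by rewrite invr_gt0.
have tr : t * t^-1 = 1 by rewrite mulfV// gt_eqF.
move: tr r0; move: (t^-1) => r tr r0.
have [t1|t1] := leP t 2^-1.
  have : 2^-1 ^+ 2 <= (t - 1) ^+ 2 by nra.
  by have := sqr_ge0 r; nra.
have : r <= 2 by nra.
have := mulr_ge0 (sqr_ge0 (t - 1)) (addr_ge0 ler01 (sqr_ge0 r)).
by nra.
Qed.

(* [dev2 (v / (k+2))] times the Poisson weight at [k+2] is a combination of the
   Poisson weights at [k], ..., [k+4]; these are its coefficients. *)
Definition dev2_coef k : nat -> R := nth 0
  [:: (k%:R + 2) / (k%:R + 1); - 2; 2; - 2 * (k%:R + 3) / (k%:R + 2);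
      (k%:R + 4) * (k%:R + 3) / (k%:R + 2) ^+ 2].

(** The expectation of [dev2 (V / (k + 2))] for [V] with the Gamma density of shape [k + 3] and rate
    1, since all Poisson weights have the same integral. *)
Definition dev2_mean k : R := \sum_(j < 5) dev2_coef k j.

(** The rate [1 / k] quantifies the concentration at [t = 1]; the difference of the two sides is an
    explicit positive fraction. *)
Lemma dev2_mean_ubound k : dev2_mean k <= 3 / (k%:R + 1).
Proof.
rewrite /dev2_mean !big_ord_recl big_ord0 /dev2_coef /=.
have : (0 : R) <= k%:R by rewrite ler0n.
move: (k%:R : R) => n n0.
rewrite -subr_ge0.
set d := (X in 0 <= X).
suff -> : d = (n ^+ 2 + 3 * n + 4) / ((n + 1) * (n + 2) ^+ 2).
  by rewrite divr_ge0// ?mulr_ge0 ?exprn_ge0//; nra.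
by rewrite /d; field; rewrite !gt_eqF//; lra.
Qed.

(** [dev2 t = t^2 - 2 t + 2 - 2 t^-1 + t^-2], and each power of [t] shifts the Poisson index. The
    power [t^-2] lowers it by two, whence counts of the form [k.+2]. *)
Lemma sum_dev2_coef_poisson k mu u : 0 < mu -> 0 < u ->
  \sum_(j < 5) dev2_coef k j * poisson_pmf (u * mu) (k + j) =
  dev2 (u * mu / k.+2%:R) * poisson_pmf (u * mu) k.+2.
Proof.
move=> mu0 u0; have v0 : 0 < u * mu by rewrite mulr_gt0.
rewrite !big_ord_recl big_ord0 /dev2_coef /dev2 /= !poisson_pmfE//.
move: v0; move: (u * mu) => v v0.
rewrite /bump /= !addnS !addn0 !factS !natrM !exprS.
have f0 : (0 : R) < k`!%:R by rewrite ltr0n fact_gt0.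
have n0 : (0 : R) <= k%:R by rewrite ler0n.
rewrite -![in RHS]natr1 -![k.+4%:R]natr1 -![k.+3%:R]natr1 -![k.+2%:R]natr1 -![k.+1%:R]natr1.
move: f0 n0; move: (k`!%:R : R) (k%:R : R) (expR (- v)) => F n E F0 n0.
by field; rewrite !gt_eqF//; lra.
Qed.

Variables (s a : R).
Hypotheses (s01 : 0 < s < 1) (a1 : 1 <= a).
Local Notation f := (mix_pdf s a).
Local Notation marg := (marg_lik s a).

Lemma dev2_affine_poisson k mu u A B : 0 < mu -> 0 < u ->
  (A + B * dev2 (u * mu / k.+2%:R)) * poisson_pmf (u * mu) k.+2 =
  \sum_(j < 5) (B * dev2_coef k j + A *+ (nat_of_ord j == 2%N)) * poisson_pmf (u * mu) (k + j).
Proof.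
move=> mu0 u0; rewrite mulrDl -mulrA -sum_dev2_coef_poisson// mulr_sumr.
under [RHS]eq_bigr do rewrite mulrDl -mulrA.
rewrite big_split /= addrC; congr (_ + _).
rewrite (bigD1 (inord 2))//= inordK// eqxx addn2 big1 ?addr0// => j j2.
rewrite (_ : (nat_of_ord j == 2%N) = false) ?mul0r//.
by apply: contraNF j2 => /eqP j2; apply/eqP/val_inj; rewrite /= inordK.
Qed.

Lemma sum_dev2_affine k A B :
  \sum_(j < 5) (B * dev2_coef k j + A *+ (nat_of_ord j == 2%N)) = A + B * dev2_mean k.
Proof.
rewrite big_split /= -mulr_sumr addrC; congr (_ + _).
by rewrite !big_ord_recl big_ord0 /= !addr0 !add0r.
Qed.

Lemma marg_lik_le_dev2 k mu A B : 0 < mu ->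
  (forall u, 0 < u -> f u <= A + B * dev2 (u * mu / k.+2%:R)) ->
  marg k.+2 mu <= (A + B * dev2_mean k) / mu.
Proof.
move=> mu0 fle; rewrite -lee_fin -marg_likE// -sum_dev2_affine.
rewrite -(integral_sum_poisson_pmf k 5
  (fun j => B * dev2_coef k j + A *+ (j == 2%N)))//.
apply: le_integral; [exact: measurable_itv|exact: integrable_mix_poisson| |].
  exact: (integrable_sum_poisson_pmf k 5 (fun j => B * dev2_coef k j + A *+ (j == 2%N)) mu0).
move=> u /[1!inE] /set_itv0y u0; rewrite lee_fin -dev2_affine_poisson//.
by rewrite ler_wpM2r ?poisson_pmf_ge0// fle.
Qed.

(** [B] is negative in the application, so the minorant may change sign; this is why the comparison
    goes through integrable functions and not nonnegative ones. *)
Lemma marg_lik_ge_dev2 k mu A B : 0 < mu ->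
  (forall u, 0 < u -> A + B * dev2 (u * mu / k.+2%:R) <= f u) ->
  (A + B * dev2_mean k) / mu <= marg k.+2 mu.
Proof.
move=> mu0 fle; rewrite -lee_fin -marg_likE// -sum_dev2_affine.
rewrite -(integral_sum_poisson_pmf k 5
  (fun j => B * dev2_coef k j + A *+ (j == 2%N)))//.
apply: le_integral; [exact: measurable_itv| |exact: integrable_mix_poisson|].
  exact: (integrable_sum_poisson_pmf k 5 (fun j => B * dev2_coef k j + A *+ (j == 2%N)) mu0).
move=> u /[1!inE] /set_itv0y u0; rewrite lee_fin -dev2_affine_poisson//.
by rewrite ler_wpM2r ?poisson_pmf_ge0// fle.
Qed.

(** With [t = u * exp th / y], [ln y = ln u + th - ln t]; submultiplicativity distributes
    [logw (ln y)] over the three terms. The first cancels the decay of the density, the second is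
    kept, and the third becomes [1 + t^-2]. The constants come from [mix_pdf_logw_bounded],
    [H_pdf_tail_lbound] and [logw_ln_div]. *)
Lemma mix_pdf_le_scaled : exists2 K : R, 0 < K & forall y th u, 1 <= y -> 0 < u ->
  f u <= K * logw th * (expR th * H y) * (1 + (u * expR th / y) ^- 2).
Proof.
have [C C0 hC] := mix_pdf_logw_bounded s01 a1.
have p0 := pi_gt0 R.
exists (C * (4 * pi) * 32); first by rewrite !mulr_gt0.
move=> y th u y1 u0; have y0 : 0 < y by lra.
set mu := expR th; have mu0 : 0 < mu by exact: expR_gt0.
set t := u * mu / y; have t0 : 0 < t by rewrite divr_gt0// mulr_gt0.
have wt0 := logw_gt0 (ln t); have wu0 := logw_gt0 (ln u).
have wy0 := logw_gt0 (ln y); have w0 := logw_gt0 th.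
have Hy0 := H_pdf_gt0 y0.
have h1 := hC u u0.
have h2 : logw (ln y) <= logw (ln u) * (logw th * logw (ln t)).
  have -> : ln y = ln u + (th + - ln t).
    rewrite /t ln_div ?posrE ?mulr_gt0// lnM ?posrE// expRK; ring.
  apply: (le_trans (logwD _ _)); rewrite ler_pM2l//.
  by apply: (le_trans (logwD _ _)); rewrite logwN.
have h3 : 1 <= 4 * pi * (y * H y * logw (ln y)).
  have := H_pdf_tail_lbound y1.
  by rewrite -div1r ler_pdivrMr ?mulr_gt0// [X in _ <= X -> _]mulrC.
have h4 : logw (ln t) <= 32 * (1 + t ^- 2) * t.
  by rewrite -ler_pdivrMr//; exact: logw_ln_div.
have f0 : 0 <= f u by exact: mix_pdf_ge0.
have h5 : 1 <= 4 * pi * (y * H y * (logw (ln u) * (logw th * (32 * (1 + t ^- 2) * t)))).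
  apply: (le_trans h3); rewrite ler_pM2l; last by rewrite mulr_gt0.
  rewrite ler_pM2l; last exact: mulr_gt0 y0 Hy0.
  by apply: (le_trans h2); rewrite ler_pM2l// ler_pM2l.
have -> : C * (4 * pi) * 32 * logw th * (mu * H y) * (1 + t ^- 2) =
  C * (4 * pi * H y * logw th * mu * 32 * (1 + t ^- 2)) by ring.
apply: le_trans (ler_wpM2r _ h1); last first.
  apply: mulr_ge0; last by rewrite addr_ge0// invr_ge0 exprn_ge0// ltW.
  have n4 : (0 : R) < 4 by []; have n32 : (0 : R) < 32 by [].
  exact: ltW (mulr_gt0 (mulr_gt0 (mulr_gt0 (mulr_gt0 (mulr_gt0 n4 p0) Hy0) w0) mu0) n32).
rewrite -[leLHS]mulr1.
have -> : f u * (u * logw (ln u)) * (4 * pi * H y * logw th * mu * 32 * (1 + t ^- 2)) =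
  f u * (4 * pi * (y * H y * (logw (ln u) * (logw th * (32 * (1 + t ^- 2) * t))))).
  move: h5 h4; rewrite (_ : t = u * mu / y)//; move: ((u * mu / y) ^- 2) => q _ _.
  by move: (pi : R) => P; field; rewrite gt_eqF.
by rewrite ler_wpM2l.
Qed.

Lemma marg_lik_growth : exists2 C : R, 0 < C & forall k th,
  marg k.+2 (expR th) <= C * logw th * H k.+2%:R.
Proof.
have [K K0 hK] := mix_pdf_le_scaled.
(* 17 is [5 + 4 * 3]: [dev2_cover] with a mean of [dev2] at most 3. *)
exists (K * 17); first by rewrite mulr_gt0.
move=> k th; set mu := expR th; have mu0 : 0 < mu by exact: expR_gt0.
have y1 : (1 : R) <= k.+2%:R by rewrite ler1n.
have Hy0 : 0 < H k.+2%:R by apply: H_pdf_gt0; rewrite ltr0n.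
have w0 := logw_gt0 th.
pose A := K * logw th * (mu * H k.+2%:R).
have A0 : 0 < A by rewrite /A; apply: mulr_gt0; apply: mulr_gt0.
apply: (@le_trans _ _ ((A * 5 + (A * 4) * dev2_mean k) / mu)).
  apply: marg_lik_le_dev2 => // u u0; apply: (le_trans (hK _ th _ y1 u0)).
  rewrite -/mu -/A -(mulrA A) -mulrDr ler_pM2l//; apply: dev2_cover.
  by rewrite divr_gt0 ?mulr_gt0// ltr0n.
have hm : dev2_mean k <= 3.
  apply: (le_trans (dev2_mean_ubound k)); rewrite ler_pdivrMr; last by rewrite ltr_wpDl.
  by have : (0 : R) <= k%:R by []; lra.
rewrite ler_pdivrMr//.
have -> : K * 17 * logw th * H k.+2%:R * mu = A * 17 by rewrite /A; ring.
by nra.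
Qed.

(** Near [t = 1], monotonicity squeezes [H u] between two dilations of [y], where slow variation
    applies. Away from 1, [dev2 t] is at least [e^2 (1 + t^-2)] and absorbs the uniform bound of
    [mix_pdf_le_scaled]. *)
Lemma mix_pdf_tail_dev2 mu e : 0 < mu -> 0 < e <= 2^-1 ->
  exists2 B : R, 0 <= B & \forall y \near +oo, forall u, 0 < u ->
    `|f u - s * (mu * H y)| <= (mu * H y) * (6 * e + B * dev2 (u * mu / y)).
Proof.
move=> mu0 /andP[e0 e1]; have /andP[s0 s1] := s01.
have [K K0 hK] := mix_pdf_le_scaled.
have [C C0 hC] := mix_pdf_ubound s01 a1.
(* Adding 1 ensures [K' > 1 > s], so that the lower estimate away from [t = 1] follows from
   [f u >= 0]. *)
pose K' := K * logw (ln mu) + 1.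
have w0 := logw_gt0 (ln mu).
have K'0 : 1 < K' by rewrite /K' ltrDr mulr_gt0.
exists (K' / e ^+ 2); first by rewrite divr_ge0 ?exprn_ge0//; lra.
pose c1 := (1 - e) / mu; pose c2 := (1 + e) / mu.
have c10 : 0 < c1 by rewrite divr_gt0//; lra.
have c20 : 0 < c2 by rewrite divr_gt0//; lra.
have /cvgrPdist_le L1 := H_pdf_slow c10.
have /cvgrPdist_le L2 := H_pdf_slow c20.
have me0 : 0 < mu * e by rewrite mulr_gt0.
near=> y.
have y1 : 1 <= y by near: y; exact: nbhs_pinfty_ge (num_real _).
have y0 : 0 < y by lra.
have yC : C / e / c1 <= y by near: y; exact: nbhs_pinfty_ge (num_real _).
have l1 : `|c1^-1 - H (c1 * y) / H y| <= mu * e by near: y; exact: L1.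
have l2 : `|c2^-1 - H (c2 * y) / H y| <= mu * e by near: y; exact: L2.
have Hy0 := H_pdf_gt0 y0.
move=> u u0; set t := u * mu / y; have t0 : 0 < t by rewrite divr_gt0// mulr_gt0.
have uE : u = t / mu * y by rewrite /t; field; rewrite !gt_eqF.
have M0 : 0 < mu * H y by rewrite mulr_gt0.
have d20 : 0 <= dev2 t by rewrite mulr_ge0 ?sqr_ge0// addr_ge0// invr_ge0 sqr_ge0.
have [te|te] := leP `|t - 1| e.
  have /andP[te1 te2] : 1 - e <= t <= 1 + e by move: te; rewrite ler_distl.
  have Hu0 := H_pdf_gt0 u0.
  have hu1 : H u <= mu * H y * (1 + 3 * e).
    apply: (@le_trans _ _ (H (c1 * y))).
      apply: H_pdf_nincr; first by rewrite mulr_gt0.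
      by rewrite uE ler_pM2r// ler_pM2r// invr_gt0.
    have : H (c1 * y) / H y <= c1^-1 + mu * e by move: l1; rewrite ler_distl; lra.
    rewrite ler_pdivrMr// => /le_trans; apply.
    rewrite mulrAC ler_wpM2r ?(ltW Hy0)// /c1 invf_div.
    have : mu / (1 - e) <= mu * (1 + 2 * e).
      by rewrite ler_wpM2l ?(ltW mu0)// -[leLHS]mul1r ler_pdivrMr; nra.
    by lra.
  have hu2 : mu * H y * (1 - 2 * e) <= H u.
    apply: (@le_trans _ _ (H (c2 * y))); last first.
      apply: H_pdf_nincr => //.
      by rewrite uE ler_pM2r// ler_pM2r// invr_gt0.
    have : c2^-1 - mu * e <= H (c2 * y) / H y by move: l2; rewrite ler_distl; lra.
    rewrite ler_pdivlMr//; apply: le_trans.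
    rewrite mulrAC ler_wpM2r ?(ltW Hy0)// /c2 invf_div.
    have : mu * (1 - e) <= mu / (1 + e).
      by rewrite ler_wpM2l ?(ltW mu0)// -[leRHS]mul1r ler_pdivlMr; nra.
    by lra.
  (* The Gamma component is negligible here, because [u >= c1 * y] is large. *)
  have uC : C / (1 + u) <= e.
    have : C / e <= u.
      rewrite ler_pdivrMr// in yC; apply: (le_trans yC).
      by rewrite mulrC uE ler_pM2r// ler_pM2r// invr_gt0.
    rewrite ler_pdivrMr// => h; rewrite ler_pdivrMr; last by lra.
    by nra.
  have fu1 : f u <= H u * (s + e).
    apply: (le_trans (hC u u0)); rewrite mulrDr (mulrC s) lerD2l.
    by rewrite mulrCA ler_pM2l.
  have fu2 : s * H u <= f u by exact: mix_pdf_lbound.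
  have dB : 0 <= K' / e ^+ 2 * dev2 t by rewrite mulr_ge0// divr_ge0 ?exprn_ge0//; lra.
  apply: (@le_trans _ _ (mu * H y * (6 * e))); last by rewrite ler_pM2l// lerDl.
  rewrite ler_distl; apply/andP; split.
    apply: le_trans fu2; apply: (@le_trans _ _ (s * (mu * H y * (1 - 2 * e)))).
      have se : 0 <= 6 * e - 2 * (s * e) by nra.
      have := mulr_ge0 (ltW M0) se; move: (mu * H y) => M; lra.
    by rewrite ler_pM2l.
  apply: (le_trans fu1); apply: (@le_trans _ _ (mu * H y * (1 + 3 * e) * (s + e))).
    by rewrite ler_wpM2r//; lra.
  have : (1 + 3 * e) * (s + e) <= s + 6 * e by nra.
  by rewrite -(ler_pM2l M0); nra.
have fu0 : 0 <= f u by exact: mix_pdf_ge0.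
have fu1 : f u <= (K' - 1) * (mu * H y) * (1 + t ^- 2).
  have := hK y (ln mu) u y1 u0; rewrite lnK ?posrE// -/t.
  by rewrite /K' addrK.
have q0 : 0 <= t ^- 2 by rewrite invr_ge0 exprn_ge0// ltW.
have hd : K' * (1 + t ^- 2) <= K' / e ^+ 2 * dev2 t.
  rewrite /dev2 mulrA ler_wpM2r//; first by lra.
  rewrite mulrAC ler_pdivlMr ?exprn_gt0// ler_wpM2l//; first by lra.
  by rewrite -[leRHS]real_normK ?num_real// lerXn2r ?nnegrE// ltW.
apply: (@le_trans _ _ (mu * H y * (K' * (1 + t ^- 2)))); last first.
  by rewrite ler_pM2l//; lra.
move: M0 fu1; move: (mu * H y) => M M0 fu1.
rewrite ler_distl; apply/andP; split; nra.
Unshelve. all: by end_near. Qed.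

Lemma marg_lik_tail mu : 0 < mu ->
  marg k mu / H k%:R @[k --> \oo] --> s.
Proof.
move=> mu0; apply/cvgrPdist_le => e' e'0.
(* Six parts of the error come from [mix_pdf_tail_dev2], the seventh from the mean of [dev2]. *)
pose e := Num.min 2^-1 (e' / 7).
have e0 : 0 < e by rewrite lt_min invr_gt0 ltr0n divr_gt0.
have e1 : e <= 2^-1 by rewrite ge_min lexx.
have e2 : 7 * e <= e'.
  by rewrite mulrC -ler_pdivlMr// ge_min lexx orbT.
have [B B0 hB] := mix_pdf_tail_dev2 mu0 (introT andP (conj e0 e1)).
have hBn : \forall k \near \oo, forall u, 0 < u ->
    `|f u - s * (mu * H k%:R)| <= (mu * H k%:R) * (6 * e + B * dev2 (u * mu / k%:R)).
  by apply: (@cvgr_idn R) hB.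
suff key n : (2 <= n)%N -> 3 * B / e + 1 <= n%:R -> (forall u, 0 < u ->
    `|f u - s * (mu * H n%:R)| <= (mu * H n%:R) * (6 * e + B * dev2 (u * mu / n%:R))) ->
    `|s - marg n mu / H n%:R| <= e'.
  near=> n; apply: key.
  - by near: n; exact: nbhs_infty_ge.
  - by near: n; exact: nbhs_infty_ger.
  - by near: n; exact: hBn.
case: n => [|[|k]]// _ nB hn.
set M := H k.+2%:R in hn *.
have M0 : 0 < M by apply: H_pdf_gt0; rewrite ltr0n.
have hm : B * dev2_mean k <= e.
  have k0 : (0 : R) <= k%:R by [].
  apply: (@le_trans _ _ (B * (3 / (k%:R + 1)))).
    by rewrite ler_wpM2l// dev2_mean_ubound.
  rewrite mulrA ler_pdivrMr; last by lra.
  rewrite -!natr1 in nB.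
  have : 3 * B / e <= k%:R + 1 by lra.
  by rewrite ler_pdivrMr//; lra.
have up : marg k.+2 mu <= ((s + 6 * e) * (mu * M) + B * (mu * M) * dev2_mean k) / mu.
  apply: marg_lik_le_dev2 => // u u0.
  by have := hn u u0; rewrite ler_distl => /andP[_]; lra.
have lo : ((s - 6 * e) * (mu * M) + - (B * (mu * M)) * dev2_mean k) / mu <= marg k.+2 mu.
  apply: marg_lik_ge_dev2 => // u u0.
  by have := hn u u0; rewrite ler_distl => /andP[+ _]; lra.
have up' : marg k.+2 mu <= M * (s + 6 * e + B * dev2_mean k).
  by apply: (le_trans up); rewrite ler_pdivrMr// le_eqVlt; apply/orP; left; apply/eqP; ring.
have lo' : M * (s - 6 * e - B * dev2_mean k) <= marg k.+2 mu.
  by apply: le_trans lo; rewrite ler_pdivlMr// le_eqVlt; apply/orP; left; apply/eqP; ring.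
apply: le_trans e2; rewrite distrC ler_distl ler_pdivlMr// ler_pdivrMr//.
apply/andP; split; nra.
Unshelve. all: by end_near. Qed.

End marginal_tail.

(** * Coercivity and Gaussian domination *)

Section quadratic_form.
Context {R : realType}.
Implicit Types k : nat.

Lemma posdef_unitmx k (Sigma : 'M[R]_k) : posdef Sigma -> Sigma \in unitmx.
Proof.
move=> [_ pd]; rewrite -row_free_unit; apply: inj_row_free => v v0.
apply/eqP; apply: contraT => vn0.
by have := pd v vn0; rewrite v0 mul0mx mxE ltxx.
Qed.

Lemma posdef_ge0 k (Sigma : 'M[R]_k) (v : 'rV[R]_k) :
  posdef Sigma -> 0 <= (v *m Sigma *m v^T) 0 0.
Proof.
move=> [_ pd]; have [->|v0] := eqVneq v 0; last exact/ltW/pd.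
by rewrite !mul0mx mxE.
Qed.

(* Nonnegativity of the form [Sigma] at [w - t e_j], [w = v Sigma^-1], at the
   minimizing [t]. *)
Lemma posdef_inv_coord k (Sigma : 'M[R]_k) (v : 'rV[R]_k) (j : 'I_k) : posdef Sigma ->
  (v 0 j) ^+ 2 <= Sigma j j * (v *m invmx Sigma *m v^T) 0 0.
Proof.
move=> pd; have uS := posdef_unitmx pd; have [sym pos] := pd.
set w := v *m invmx Sigma.
have vE : v = w *m Sigma by rewrite /w mulmxKV.
pose e : 'rV[R]_k := delta_mx 0 j.
have eSe : (e *m Sigma *m e^T) 0 0 = Sigma j j.
  by rewrite -rowE trmx_delta -colE !mxE.
have Sjj : 0 < Sigma j j.
  rewrite -eSe; apply: pos; apply/eqP => /matrixP/(_ 0 j)/eqP.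
  by rewrite !mxE !eqxx oner_eq0.
have wSe : (w *m Sigma *m e^T) 0 0 = v 0 j.
  by rewrite -vE trmx_delta -colE mxE.
have eSw : (e *m Sigma *m w^T) 0 0 = v 0 j.
  rewrite -wSe -[in RHS](trmxK w) -[in RHS]sym -trmx_mul -trmx_mul.
  by rewrite mulmxA [RHS]mxE.
have wSw : (w *m Sigma *m w^T) 0 0 = (w *m v^T) 0 0.
  have vT : v^T = Sigma *m w^T by rewrite {1}vE trmx_mul sym.
  by rewrite vT mulmxA.
pose t := v 0 j / Sigma j j.
pose q (x y : 'rV[R]_k) : R := (x *m Sigma *m y^T) 0 0.
have qBl x y z : q (x - y) z = q x z - q y z.
  by rewrite /q !mulmxBl [LHS]mxE; congr (_ + _); rewrite mxE.
have qBr x y z : q z (x - y) = q z x - q z y.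
  by rewrite /q raddfB /= mulmxBr [LHS]mxE; congr (_ + _); rewrite mxE.
have qZl r x y : q (r *: x) y = r * q x y by rewrite /q -!scalemxAl mxE.
have qZr r x y : q y (r *: x) = r * q y x by rewrite /q linearZ /= -scalemxAr mxE.
have := posdef_ge0 (w - t *: e) pd.
rewrite -/(q _ _) qBl !qBr !qZl !qZr /q wSw wSe eSw eSe.
have tE : t * Sigma j j = v 0 j by rewrite /t divfK// gt_eqF.
rewrite tE subrr subr0 subr_ge0 => h.
have -> : v 0 j ^+ 2 = Sigma j j * (t * v 0 j) by rewrite expr2 -{1}tE; ring.
by rewrite ler_pM2l.
Qed.

(** Summing the coordinate bounds gives the inverse trace as a coercivity constant, with no spectral
    theory; the added 1 covers dimension 0. *)
Lemma posdef_inv_coercive k (Sigma : 'M[R]_k) : posdef Sigma ->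
  exists2 lam : R, 0 < lam & forall v : 'rV[R]_k,
    lam * (\sum_j v 0 j ^+ 2) <= (v *m invmx Sigma *m v^T) 0 0.
Proof.
move=> pd; pose T := \sum_j Sigma j j.
have Sjj j : 0 <= Sigma j j.
  have := posdef_ge0 (delta_mx 0 j) pd.
  by rewrite -rowE trmx_delta -colE !mxE.
have T0 : 0 <= T by apply: sumr_ge0.
exists (T + 1)^-1; first by rewrite invr_gt0; lra.
move=> v; rewrite mulrC ler_pdivrMr; last by lra.
set q := (v *m invmx Sigma *m v^T) 0 0.
have q0 : 0 <= q.
  rewrite /q; set w := v *m invmx Sigma.
  have vE : v = w *m Sigma by rewrite /w mulmxKV// posdef_unitmx.
  have vT : v^T = Sigma *m w^T by rewrite {1}vE trmx_mul pd.1.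
  by rewrite vT mulmxA; exact: posdef_ge0.
apply: (@le_trans _ _ (T * q)); last by rewrite mulrDr mulr1 mulrC lerDl.
by rewrite /T mulr_suml; apply: ler_sum => j _; exact: posdef_inv_coord.
Qed.

Lemma mvn_pdf_ubound k (m : 'rV[R]_k) (Sigma : 'M[R]_k) : posdef Sigma ->
  exists c C : R, [/\ 0 < c, 0 < C & forall v : k.-tuple R,
    mvn_pdf m Sigma v <= C * \prod_(j < k) expR (- (c * tnth v j ^+ 2))].
Proof.
move=> pd; have [lam lam0 hlam] := posdef_inv_coercive pd.
pose Z := (Num.sqrt ((pi *+ 2) ^+ k * \det Sigma))^-1.
pose B := expR (2^-1 * lam * \sum_j m 0 j ^+ 2).
have B0 : 0 < B by exact: expR_gt0.
have Z0 : 0 <= Z by rewrite invr_ge0.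
(* The mean is removed by [v^2 <= 2 (v - m)^2 + 2 m^2], which halves the rate; [Z + 1] keeps the
   constant positive even if [Z] is 0. *)
exists (lam / 4), ((Z + 1) * B); split; [by rewrite divr_gt0|by rewrite mulr_gt0//; lra|].
move=> v; rewrite /mvn_pdf -/Z -expR_sum -mulrA.
have le1 : expR (- 2^-1 * ((row_of v - m) *m invmx Sigma *m (row_of v - m)^T) 0 0) <=
   B * expR (\sum_(j < k) - (lam / 4 * tnth v j ^+ 2)).
  rewrite /B -expRD ler_expR.
  have h := hlam (row_of v - m).
  rewrite sumrN -mulr_sumr.
  have : \sum_j tnth v j ^+ 2 <= 2 * (\sum_j (row_of v - m) 0 j ^+ 2 + \sum_j m 0 j ^+ 2).
    rewrite -big_split /= mulr_sumr; apply: ler_sum => j _; rewrite !mxE.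
    have := sqr_ge0 (tnth v j - m 0 j *+ 2); rewrite mulr2n; nra.
  rewrite -(ler_pM2l lam0); lra.
by apply: ler_pM; rewrite ?expR_ge0 ?lerDl.
Qed.

End quadratic_form.

(** * Few predictors can be small; trading large factors against growing ones *)

Section coercivity.
Context {R : realType}.

Definition norm1 k (v : k.-tuple R) : R := \sum_(j < k) `|tnth v j|.

Lemma norm1_ge0 k (v : k.-tuple R) : 0 <= norm1 v.
Proof. exact: sumr_ge0. Qed.

Lemma dotp_le_norm1 k (v w : k.-tuple R) (M : R) :
  (forall j, `|tnth w j| <= M) -> `|dotp v w| <= norm1 v * M.
Proof.
move=> wM; rewrite /dotp /norm1 mulr_suml.
apply: (le_trans (ler_norm_sum _ _ _)); apply: ler_sum => j _.
by rewrite normrM ler_wpM2l.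
Qed.

Lemma coord_le_norm1 k (v : k.-tuple R) j : `|tnth v j| <= norm1 v.
Proof. by rewrite /norm1 (bigD1 j)//= lerDl sumr_ge0. Qed.

Lemma xi_block_le_norm1 n q (xi : (n * q).-tuple R) i j :
  `|tnth (xi_block xi i) j| <= norm1 xi.
Proof.
(* [xi_block] reads with default 0, so an index out of range satisfies the bound as well. *)
rewrite tnth_mktuple; have [h|h] := ltnP (i * q + j) (n * q).
  by rewrite -[(i * q + j)%N]/(nat_of_ord (Ordinal h)) -tnth_nth coord_le_norm1.
by rewrite nth_default ?size_tuple// normr0 norm1_ge0.
Qed.

(** The [p] covariates form an invertible square matrix, and a left inverse recovers each coordinate
    of [beta] from the predictors. *)
Lemma lin_indep_coercive n p (x : 'I_n -> p.-tuple R) (S : {set 'I_n}) :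
  #|S| = p -> lin_indep x S -> exists2 C : R, 0 <= C &
    forall beta, norm1 beta <= C * \sum_(i in S) `|dotp (x i) beta|.
Proof.
move=> cS li.
pose A : 'M[R]_(#|S|, p) := \matrix_(i, j) tnth (x (enum_val i)) j.
have rfA : row_free A.
  apply: inj_row_free => w wA; apply/rowP => k; rewrite mxE.
  (* Carries coefficients indexed by the enumeration of [S] back to all indices. *)
  pose c i := \sum_(k | enum_val k == i) w 0 k.
  have cE k' : c (enum_val k') = w 0 k'.
    rewrite /c (big_pred1 k')// => k''.
    by rewrite (inj_eq enum_val_inj).
  rewrite -cE; apply: li (enum_valP k) => j.
  rewrite big_enum_val /=; move/matrixP/(_ 0 j): wA; rewrite !mxE => wA.
  by rewrite -[RHS]wA; apply: eq_bigr => i _; rewrite cE mxE.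
have /row_fullP [B BA] : row_full A.
  by move: rfA; rewrite /row_free /row_full => /eqP ->; rewrite cS.
exists (\sum_j \sum_k `|B j k|); first by apply: sumr_ge0 => j _; apply: sumr_ge0.
move=> beta; rewrite [X in _ * X]big_enum_val /= /norm1 mulr_suml; apply: ler_sum => j _.
have -> : tnth beta j = \sum_k B j k * dotp (x (enum_val k)) beta.
  pose b : 'cV[R]_p := \col_j tnth beta j.
  have : B *m (A *m b) = b by rewrite mulmxA BA mul1mx.
  move/matrixP/(_ j 0); rewrite !mxE => <-; apply: eq_bigr => k _; congr (_ * _).
  by rewrite mxE; apply: eq_bigr => l _; rewrite !mxE.
apply: (le_trans (ler_norm_sum _ _ _)); rewrite mulr_suml; apply: ler_sum => k _.
rewrite normrM ler_wpM2l//.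
by rewrite (bigD1 k)//= lerDl sumr_ge0.
Qed.

Lemma subset_of_card (T : finType) (A : {set T}) k : (k <= #|A|)%N ->
  exists2 S : {set T}, S \subset A & #|S| = k.
Proof.
move=> kA; exists [set x in take k (enum A)].
  by apply/fintype.subsetP => x; rewrite inE => /mem_take; rewrite mem_enum.
rewrite cardsE (card_uniqP _) ?take_uniq ?enum_uniq// size_take -cardE.
by case: ltngtP kA.
Qed.

(** If [p] predictors were below [c * norm1 beta], coercivity over these [p] indices would be
    contradicted. Summing the constants over all subsets makes [c] independent of the choice. *)
Lemma few_small_coords n p (x : 'I_n -> p.-tuple R) (P : {set 'I_n}) :
  (forall S : {set 'I_n}, S \subset P -> #|S| = p -> lin_indep x S) ->
  exists2 c : R, 0 < c & forall beta, 0 < norm1 beta ->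
    (#|[set i in P | (`|dotp (x i) beta| < c * norm1 beta)%R]| < p)%N.
Proof.
move=> li.
have /choice[Cf hCf] : forall S : {set 'I_n}, exists C : R, 0 <= C /\
    (S \subset P -> #|S| = p ->
     forall beta, norm1 beta <= C * \sum_(i in S) `|dotp (x i) beta|).
  move=> S; have [/andP[SP /eqP cS]|nS] := boolP ((S \subset P) && (#|S| == p)).
    by have [C C0 hC] := lin_indep_coercive cS (li S SP cS); exists C.
  exists 0; split => // SP cS; by rewrite SP cS eqxx in nS.
pose C := \sum_S Cf S.
have Cf0 S : 0 <= Cf S by case: (hCf S).
have C0 : 0 <= C by exact: sumr_ge0.
have p0 : (0 : R) <= p%:R by [].
exists (C * p%:R + 1)^-1; first by rewrite invr_gt0 ltr_wpDl// mulr_ge0.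
set c := _^-1 => beta b0; rewrite ltnNge; apply/negP => /subset_of_card[S SB cS].
have SP : S \subset P.
  by apply: fintype.subset_trans SB _; apply/fintype.subsetP => i; rewrite inE => /andP[].
have h := (hCf S).2 SP cS beta.
have CfC : Cf S <= C by rewrite /C (bigD1 S)//= lerDl sumr_ge0.
have hs : \sum_(i in S) `|dotp (x i) beta| <= p%:R * (c * norm1 beta).
  have -> : p%:R * (c * norm1 beta) = \sum_(i in S) (c * norm1 beta).
    by rewrite sumr_const cS mulr_natl.
  apply: ler_sum => i iS.
  by move/fintype.subsetP: SB => /(_ i iS); rewrite inE => /andP[_ /ltW].
have : norm1 beta <= C * (p%:R * (c * norm1 beta)).
  apply: (le_trans h); apply: ler_pM => //; exact: sumr_ge0.
have -> : C * (p%:R * (c * norm1 beta)) = norm1 beta * ((C * p%:R) / (C * p%:R + 1)).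
  by rewrite /c; ring.
rewrite -[leLHS]mulr1 ler_pM2l// ler_pdivlMr; last by rewrite ltr_wpDl// mulr_ge0.
by lra.
Qed.

Lemma ler_prod_expn (T : finType) (A : {set T}) (F : T -> R) (r : R) :
  0 <= r -> (forall i, i \in A -> r <= F i) -> r ^+ #|A| <= \prod_(i in A) F i.
Proof.
move=> r0 rF; rewrite -prodr_const; apply: ler_prod => i iA.
by rewrite r0 rF.
Qed.

(* All but few factors of [P] are at least of order [B / G], and every factor is at
   least [1]; enough of them remain to pay for the [#|Ls|] factors of order [B G]. *)
Lemma prod_weight_trade (T : finType) (Ls P : {set T}) (X Z c : R) :
  0 <= X -> 0 <= Z -> 0 < c -> exists2 D : R, 0 < D &
  forall (b z : T -> R) (B G : R), 0 <= B -> 1 <= G ->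
    (forall i, `|b i| <= X * B) -> (forall i, `|z i| <= Z * G) ->
    (0 < B -> (#|[set i in P | (`|b i| < c * B)%R]| + #|Ls| <= #|P|)%N) ->
    \prod_(i in Ls) (1 + `|b i + z i|) <=
      (D * G ^+ 2) ^+ #|Ls| * \prod_(i in P) (1 + `|b i + z i|).
Proof.
move=> X0 Z0 c0; pose D1 := 1 + X + Z; pose D2 := 1 + (1 + Z) / c.
have D10 : 0 < D1 by rewrite /D1; lra.
have D21 : 1 <= D2 by rewrite /D2 lerDl divr_ge0//; lra.
have D20 : 0 < D2 by lra.
exists (D1 * D2); first by rewrite mulr_gt0.
move=> b z B G B0 G1 hb hz hP.
pose A i := 1 + `|b i + z i|.
have A1 i : 1 <= A i by rewrite /A lerDl.
(* The level of comparison: every factor is at most [D1 * D2 * G^2 * r], and every factor with a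
   large [b i] at least [r]. *)
pose r := (1 + B) / (D2 * G).
have r0 : 0 <= r by rewrite divr_ge0 ?mulr_ge0//; lra.
have up i : A i <= D1 * D2 * G ^+ 2 * r.
  have -> : D1 * D2 * G ^+ 2 * r = D1 * (1 + B) * G.
    by rewrite /r; field; rewrite !gt_eqF//; lra.
  rewrite /A /D1; have := ler_normD (b i) (z i); have := hb i; have := hz i.
  have G10 : 0 <= G - 1 by lra.
  have G0 : 0 <= G by lra.
  have := mulr_ge0 (mulr_ge0 X0 B0) G10; have := mulr_ge0 B0 G0.
  have := mulr_ge0 X0 G0; have := mulr_ge0 (mulr_ge0 Z0 B0) G0.
  lra.
have lo : r ^+ #|Ls| <= \prod_(i in P) A i.
  (* For [B = 0] nothing is known about small coordinates, but then [r <= 1]. *)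
  have := B0; rewrite le_eqVlt => /predU1P[B00|Bp].
    apply: (@le_trans _ _ 1).
      apply: exprn_ile1 => //; rewrite /r -B00 addr0 ler_pdivrMr ?mul1r; nra.
    have := @ler_prod_expn _ P A 1 ler01 (fun i _ => A1 i).
    by rewrite expr1n.
  pose bad := [set i in P | (`|b i| < c * B)%R].
  have badP : bad \subset P by apply/fintype.subsetP => i; rewrite inE => /andP[].
  have cgood : (#|Ls| <= #|P :\: bad|)%N.
    by rewrite cardsD (finset.setIidPr badP) leq_subRL ?subset_leq_card// hP.
  (* The maximum with 1 lets the power grow from [#|Ls|] to the possibly larger number of good
     indices. *)
  have good i : i \in P :\: bad -> Num.max 1 r <= A i.
    rewrite !inE => /andP[+ iP]; rewrite iP /= -leNgt => cb.
    rewrite ge_max A1 /= /r ler_pdivrMr; last by rewrite mulr_gt0//; lra.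
    have h1 : `|b i| <= `|b i + z i| + `|z i|.
      by rewrite -[X in `|X| <= _](addrK (z i)); exact: ler_normB.
    have h2 : c * B <= A i - 1 + Z * G by rewrite /A; have := hz i; lra.
    have h3 : B <= (A i - 1 + Z * G) / c by rewrite ler_pdivlMr// mulrC.
    have Ai := A1 i.
    have h4 : (A i - 1 + Z * G) / c <= (A i * G) * ((1 + Z) / c).
      rewrite mulrA ler_wpM2r ?invr_ge0 ?(ltW c0)//.
      have : Z * G <= Z * (A i * G) by rewrite ler_wpM2l//; nra.
      nra.
    have : 1 <= A i * G by nra.
    rewrite /D2; move: h4; move: ((1 + Z) / c) => d h4; nra.
  apply: (@le_trans _ _ (Num.max 1 r ^+ #|P :\: bad|)).
    apply: (@le_trans _ _ (Num.max 1 r ^+ #|Ls|)).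
      by rewrite lerXn2r ?nnegrE// ?le_max ?lexx ?orbT// ler01.
    by rewrite ler_weXn2l// le_max lexx.
  have m0 : 0 <= Num.max 1 r by rewrite le_max ler01.
  apply: (le_trans (ler_prod_expn m0 good)).
  rewrite [leRHS](big_setID bad) /= (finset.setIidPr badP) ler_peMl//.
    by apply: prodr_ge0 => i _; apply: le_trans (A1 i).
  have := @ler_prod_expn _ bad A 1 ler01 (fun i _ => A1 i).
  by rewrite expr1n.
apply: (@le_trans _ _ ((D1 * D2 * G ^+ 2 * r) ^+ #|Ls|)).
  rewrite -prodr_const; apply: ler_prod => i _.
  by rewrite up andbT addr_ge0.
rewrite exprMn ler_wpM2l// exprn_ge0// mulr_ge0 ?sqr_ge0// mulr_ge0// ltW//.
Qed.

End coercivity.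

(** * Polynomials against Gaussian products *)

Section gaussian_domination.
Context {R : realType}.
Local Notation leb := (@lebesgue_measure R).

Lemma integral_gauss_lty (c : R) : 0 < c -> exists I : R,
  (\int[leb]_z (expR (- (c * z ^+ 2)))%:E = I%:E)%E.
Proof.
move=> c0; pose sg : R := (Num.sqrt (2 * c))^-1.
have s0 : 0 < Num.sqrt (2 * c) by rewrite sqrtr_gt0 mulr_gt0.
have sg0 : sg != 0 by rewrite invr_eq0 gt_eqF.
have pk0 : 0 < normal_peak sg.
  exact: normal_peak_gt0.
exists (normal_peak sg)^-1.
transitivity (\int[leb]_z ((normal_peak sg)^-1%:E * (normal_pdf 0 sg z)%:E))%E.
  apply: eq_integral => z _; rewrite -EFinM; congr EFin.
  rewrite (_ : normal_pdf 0 sg z = normal_peak sg * normal_fun 0 sg z); last first.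
    by rewrite normal_pdfE.
  rewrite mulKf ?gt_eqF// /normal_fun subr0; congr expR.
  rewrite /sg exprVn sqr_sqrtr ?mulr_ge0 ?ltW//; field; rewrite gt_eqF//.
rewrite ge0_integralZl_EFin//.
- by rewrite integral_normal_pdf mule1.
- by move=> z _; rewrite lee_fin normal_pdf_ge0.
- by apply/measurable_EFinP; exact: measurable_normal_pdf.
- by rewrite invr_ge0 ltW.
Qed.

(** Half of the exponent is spent through [|z| <= (z^2 + 1) / 2], leaving a linear exponential that
    beats the polynomial. *)
Lemma polyM_gauss_bounded N (c : R) : 0 < c -> exists2 C : R, 0 < C & forall z,
  (1 + `|z|) ^+ N * expR (- (c * z ^+ 2)) <= C * expR (- (c / 2 * z ^+ 2)).
Proof.
move=> c0; have [C C0 hC] := polyM_expRN_bounded N c0.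
exists (C * expR (c / 2)); first by rewrite mulr_gt0 ?expR_gt0.
move=> z; have -> : expR (- (c * z ^+ 2)) = expR (- (c / 2 * z ^+ 2)) * expR (- (c / 2 * z ^+ 2)).
  by rewrite -expRD; congr expR; lra.
rewrite mulrA ler_wpM2r ?expR_ge0//.
apply: (@le_trans _ _ ((1 + `|z|) ^+ N * (expR (- (c * `|z|)) * expR (c / 2)))).
  rewrite ler_wpM2l ?exprn_ge0 ?addr_ge0// -expRD ler_expR.
  have := sqr_ge0 (`|z| - 1); rewrite -[z ^+ 2]real_normK ?num_real//.
  by rewrite -(pmulr_rge0 _ c0); nra.
by rewrite mulrA ler_wpM2r ?expR_ge0// hC.
Qed.

Lemma sum_prod_ubound (I : Type) (s : seq I) (F : I -> R) : (forall i, 0 <= F i) ->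
  1 + \sum_(i <- s) F i <= \prod_(i <- s) (1 + F i).
Proof.
move=> F0; elim: s => [|i s IH]; first by rewrite !big_nil addr0.
rewrite !big_cons; have : 0 <= \sum_(j <- s) F j by exact: sumr_ge0.
move: IH (F0 i); move: (\sum_(j <- s) F j) (\prod_(j <- s) (1 + F j)) (F i) => S Q f.
nra.
Qed.

(** [1 + norm1 v] is dominated by a product over coordinates, so that the bound factorizes and
    [Rdint_prod] integrates it. *)
Lemma norm1_gauss_domination d N (c : R) : 0 < c -> exists2 C : R, 0 < C &
  forall v : d.-tuple R,
  (1 + norm1 v) ^+ N * \prod_(j < d) expR (- (c * tnth v j ^+ 2)) <=
  C * \prod_(j < d) expR (- (c / 2 * tnth v j ^+ 2)).
Proof.
move=> c0; have [C C0 hC] := polyM_gauss_bounded N c0.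
exists (C ^+ d); first by rewrite exprn_gt0.
move=> v; apply: (@le_trans _ _ ((\prod_(j < d) (1 + `|tnth v j|)) ^+ N *
    \prod_(j < d) expR (- (c * tnth v j ^+ 2)))).
  rewrite ler_wpM2r ?prodr_ge0//.
  rewrite lerXn2r ?nnegrE ?addr_ge0 ?norm1_ge0 ?sum_prod_ubound//.
  by apply: prodr_ge0 => j _; rewrite addr_ge0.
rewrite -prodrXl -big_split /= -[X in C ^+ X]card_ord -prodr_const -big_split /=.
apply: ler_prod => j _; rewrite hC andbT.
by rewrite mulr_ge0 ?expR_ge0// exprn_ge0// addr_ge0.
Qed.

End gaussian_domination.

(** * Convergence of the posterior *)

Section double_integral.
Context {R : realType}.
Implicit Types d : nat.

(** Infinite [z] is included, both sides being 0, so a constant can be taken out of the evidence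
    before finiteness is known. *)
Lemma fine_scale (b : R) (z : \bar R) : 0 < b -> fine (b%:E * z)%E = b * fine z.
Proof.
by move=> b0; case: z => [r||] //=; rewrite ?gt0_muley ?gt0_muleNy ?lte_fin ?mulr0.
Qed.

Lemma Rdint2_scale d1 d2 (F : d1.-tuple R -> d2.-tuple R -> R) (b : R) : 0 <= b ->
  measurable_fun setT (fun z : d1.-tuple R * d2.-tuple R => F z.1 z.2) ->
  (forall v w, 0 <= F v w) ->
  Rdint (fun v => Rdint (fun w => (b * F v w)%:E)) =
  (b%:E * Rdint (fun v => Rdint (fun w => (F v w)%:E)))%E.
Proof.
move=> b0 mF F0.
have mFE : measurable_fun setT (fun z : d1.-tuple R * d2.-tuple R => (F z.1 z.2)%:E).
  exact/measurable_EFinP.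
rewrite -RdintZl//.
- apply: eq_Rdint => v; rewrite -RdintZl//.
  + exact: (measurable_fun_pair2 (f := fun z => (F z.1 z.2)%:E) v mFE).
  + by move=> w; rewrite lee_fin.
- by apply: (measurable_Rdint_param (f := fun v w => (F v w)%:E)) => // v w; rewrite lee_fin.
- by move=> v; apply: Rdint_ge0 => w; rewrite lee_fin.
Qed.

(** The product form of the bound makes the inner integrals dominated by [I2 * f1 v], so that
    dominated convergence applies twice. *)
Lemma Rdint2_dominated_convergence d1 d2
    (F_ : nat -> d1.-tuple R -> d2.-tuple R -> R) (F : d1.-tuple R -> d2.-tuple R -> R)
    (f1 : d1.-tuple R -> R) (f2 : d2.-tuple R -> R) (I1 I2 : R) :
  (forall k, measurable_fun setT (fun z : d1.-tuple R * d2.-tuple R => F_ k z.1 z.2)) ->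
  measurable_fun setT (fun z : d1.-tuple R * d2.-tuple R => F z.1 z.2) ->
  measurable_fun setT f1 -> measurable_fun setT f2 ->
  (forall k v w, 0 <= F_ k v w) -> (forall v, 0 <= f1 v) -> (forall w, 0 <= f2 w) ->
  (forall k v w, F_ k v w <= f1 v * f2 w) ->
  (forall v w, F_ ^~ v ^~ w @ \oo --> F v w) ->
  Rdint (fun v => (f1 v)%:E) = I1%:E -> Rdint (fun w => (f2 w)%:E) = I2%:E ->
  Rdint (fun v => Rdint (fun w => (F v w)%:E)) \is a fin_num /\
  (fun k => fine (Rdint (fun v => Rdint (fun w => (F_ k v w)%:E)))) @ \oo -->
    fine (Rdint (fun v => Rdint (fun w => (F v w)%:E))).
Proof.
move=> mF_ mF mf1 mf2 F_0 f10 f20 dom cF E1 E2.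
have F0 v w : 0 <= F v w.
  by apply: (cvgr_to_ge (cF v w)); near=> k; exact: F_0.
have slice (G : d1.-tuple R -> d2.-tuple R -> R) v :
    measurable_fun setT (fun z : d1.-tuple R * d2.-tuple R => G z.1 z.2) ->
    measurable_fun setT (fun w => (G v w)%:E).
  move=> mG; apply/measurable_EFinP.
  exact: (measurable_fun_pair2 (f := fun z => G z.1 z.2) v mG).
have inner (G : d1.-tuple R -> d2.-tuple R -> R) :
    measurable_fun setT (fun z : d1.-tuple R * d2.-tuple R => G z.1 z.2) ->
    (forall v w, 0 <= G v w) ->
    measurable_fun setT (fun v => Rdint (fun w => (G v w)%:E)).
  move=> mG G0; apply: (measurable_Rdint_param (f := fun v w => (G v w)%:E)).
    exact/measurable_EFinP.
  by move=> v w; rewrite lee_fin.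
have mf2E : measurable_fun setT (fun w => (f2 w)%:E) by exact/measurable_EFinP.
have mf1E : measurable_fun setT (fun w => (f1 w)%:E) by exact/measurable_EFinP.
have f20E w : (0 <= (f2 w)%:E)%E by rewrite lee_fin.
have f10E w : (0 <= (f1 w)%:E)%E by rewrite lee_fin.
have I20 : 0 <= I2 by rewrite -lee_fin -E2; exact: Rdint_ge0.
have dom2 v : Rdint (fun w => (f1 v * f2 w)%:E) = (I2%:E * (f1 v)%:E)%E.
  by rewrite muleC -E2 -RdintZl.
have [|||finF cvF] := @Rdint_dominated_convergence R d1
  (fun k v => Rdint (fun w => (F_ k v w)%:E)) (fun v => Rdint (fun w => (F v w)%:E))
  (fun v => (I2%:E * (f1 v)%:E)%E)
  (fun k => inner _ (mF_ k) (F_0 k)) (inner _ mF F0)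
  (measurable_funeM _ mf1E)
  (fun k v => Rdint_ge0 (fun w => F_0 k v w : (0 <= (F_ k v w)%:E)%E)) _ _ _.
- move=> k v; rewrite -dom2; apply: le_Rdint => //.
  + exact: slice.
  + by apply/measurable_EFinP; exact: measurable_funM.
  + by move=> w; rewrite lee_fin.
  + by move=> w; rewrite lee_fin.
- move=> v; apply: (proj2 (@Rdint_dominated_convergence R d2
    (fun k w => (F_ k v w)%:E) (fun w => (F v w)%:E) (fun w => (f1 v * f2 w)%:E) _ _ _ _ _ _ _)).
  + by move=> k; exact: slice.
  + exact: slice.
  + by apply/measurable_EFinP; exact: measurable_funM.
  + by move=> k w; rewrite lee_fin.
  + by move=> k w; rewrite lee_fin.
  + by move=> w; apply: cvg_EFin; [near=> k|exact: cF].
  + by rewrite dom2 -EFinM ltry.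
- by rewrite RdintZl// E1 -EFinM ltry.
have fin : Rdint (fun v => Rdint (fun w => (F v w)%:E)) \is a fin_num.
  by rewrite ge0_fin_numE//; apply: Rdint_ge0 => v; apply: Rdint_ge0 => w; rewrite lee_fin.
by split => //; apply: fine_cvg; rewrite fineK.
Unshelve. all: by end_near. Qed.

Lemma Rdint2_neq0 d1 d2 (F : d1.-tuple R -> d2.-tuple R -> R) (f1 : d1.-tuple R -> R) :
  measurable_fun setT (fun z : d1.-tuple R * d2.-tuple R => F z.1 z.2) ->
  measurable_fun setT f1 -> (forall v w, 0 <= F v w) -> (forall v, 0 <= f1 v) ->
  (forall v w, f1 v != 0 -> F v w != 0) -> Rdint (fun v => (f1 v)%:E) != 0%E ->
  Rdint (fun v => Rdint (fun w => (F v w)%:E)) != 0%E.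
Proof.
move=> mF mf1 F0 f10 Fn; apply: contra => /eqP I0; apply/eqP.
apply: Rdint_eq0_sub I0.
- apply: (measurable_Rdint_param (f := fun v w => (F v w)%:E)) => [|v w].
    exact/measurable_EFinP.
  by rewrite lee_fin.
- exact/measurable_EFinP.
- by move=> v; apply: Rdint_ge0 => w; rewrite lee_fin.
- by move=> v; rewrite lee_fin.
- move=> v Iv; congr EFin; apply/eqP; apply: contraT => fv.
  have /eqP[] := Rdint_cst1_neq0 (R := R) d2.
  apply: Rdint_eq0_sub Iv => //.
  + apply/measurable_EFinP.
    exact: (measurable_fun_pair2 (f := fun z => F z.1 z.2) v mF).
  + by move=> w; rewrite lee_fin.
  + by move=> w [] /eqP; rewrite (negbTE (Fn v w fv)).
Qed.

End double_integral.

Section robustness.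
Context {R : realType}.
Variables (n p q : nat) (x : 'I_n -> p.-tuple R) (g : 'I_n -> q.-tuple R) (s a : R)
  (pib : p.-tuple R -> R) (m : 'rV[R]_(n * q)) (Sigma : 'M[R]_(n * q))
  (K : {set 'I_n}) (yK : 'I_n -> nat).
Hypotheses (s01 : 0 < s < 1) (a1 : 1 <= a) (dpib : prob_density pib)
  (pdS : posdef Sigma).
Local Notation H := (@H_pdf R).
Local Notation Kpos := [set i in K | (0 < yK i)%N].
Hypotheses (cardK : (#|~: K| + p <= #|Kpos| + 1)%N)
  (indepK : forall S : {set 'I_n}, S \subset Kpos -> #|S| = p -> lin_indep x S).
Implicit Types (beta : p.-tuple R) (xi : (n * q).-tuple R).

Definition lin_pred beta xi i : R := dotp (x i) beta + dotp (g i) (xi_block xi i).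

Local Notation marg := (marg_lik s a).
Local Notation post := (posterior x g s a pib m Sigma).
Local Notation upo := (upost x g s a pib m Sigma).

Lemma rateE beta xi i : rate x g beta xi i = expR (lin_pred beta xi i).
Proof. by []. Qed.

Lemma rate_gt0 beta xi i : 0 < rate x g beta xi i.
Proof. exact: expR_gt0. Qed.

(** An outlier factor divided by its equivalent [s * H]: it tends to 1, and the divisor, free of
    [beta] and [xi], cancels in the posterior. *)
Definition out_ratio (t : 'I_n -> nat) beta xi i : R :=
  marg (t i) (rate x g beta xi i) / (s * H (t i)%:R).

Lemma mvn_pdf_ge0 v : 0 <= mvn_pdf m Sigma v.
Proof. by rewrite /mvn_pdf mulr_ge0 ?expR_ge0// invr_ge0. Qed.

Lemma upost_ge0 S y beta xi : 0 <= upo S y beta xi.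
Proof.
rewrite /upost mulr_ge0//; first by rewrite mulr_ge0 ?dpib.2.1 ?mvn_pdf_ge0.
by apply: prodr_ge0 => i _; exact: (marg_lik_ge0 a s01).
Qed.

Lemma weight_trade : exists2 D : R, 0 < D & forall beta xi,
  \prod_(i in ~: K) logw (lin_pred beta xi i) <=
  D * (1 + norm1 xi) ^+ (3 * #|~: K|) * \prod_(i in Kpos) logw (lin_pred beta xi i).
Proof.
have [c c0 hc] := few_small_coords indepK.
pose X := \sum_i norm1 (x i); pose Z := \sum_i norm1 (g i).
have X0 : 0 <= X by apply: sumr_ge0 => i _; exact: norm1_ge0.
have Z0 : 0 <= Z by apply: sumr_ge0 => i _; exact: norm1_ge0.
have [D D0 hD] := prod_weight_trade (~: K) Kpos X0 Z0 c0.
exists (pow32 (D ^+ #|~: K|)); first by rewrite pow32_gt0// exprn_gt0.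
move=> beta xi.
have G1 : 1 <= 1 + norm1 xi by rewrite lerDl norm1_ge0.
have G0 : 0 <= 1 + norm1 xi by lra.
have := hD (fun i => dotp (x i) beta) (fun i => dotp (g i) (xi_block xi i))
  (norm1 beta) (1 + norm1 xi) (norm1_ge0 _) G1.
set A := fun i => 1 + `|lin_pred beta xi i|.
have A0 i : 0 <= A i by rewrite /A addr_ge0.
move=> h; have {h} : \prod_(i in ~: K) A i <=
    (D * (1 + norm1 xi) ^+ 2) ^+ #|~: K| * \prod_(i in Kpos) A i.
  apply: h => [i|i|b0].
  - apply: (@le_trans _ _ (norm1 (x i) * norm1 beta)).
      by apply: dotp_le_norm1 => j; exact: coord_le_norm1.
    rewrite ler_wpM2r ?norm1_ge0// /X (bigD1 i)//= lerDl sumr_ge0// => k _.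
    exact: norm1_ge0.
  - apply: (@le_trans _ _ (norm1 (g i) * norm1 xi)).
      by apply: dotp_le_norm1 => j; exact: xi_block_le_norm1.
    apply: ler_pM; rewrite ?norm1_ge0//; last by rewrite lerDr.
    rewrite /Z (bigD1 i)//= lerDl sumr_ge0// => k _; exact: norm1_ge0.
  (* Strictly fewer than [p] predictors are small, which offsets the 1 in [cardK]. *)
  - have := hc beta b0 => hb; rewrite -(leq_add2r 1) addn1 -addSn addnC.
    by apply: leq_trans cardK; rewrite leq_add2l.
move/(le_pow32 (prodr_ge0 _ _)) => /(_ (fun i _ => A0 i)).
rewrite pow32M; last by rewrite exprn_ge0// mulr_ge0 ?sqr_ge0// ltW.
rewrite !pow32_prod// exprMn pow32M; last by rewrite exprn_ge0// ltW.
(* The power [3/2] turns [G^(2 l)] into [G^(3 l)], the degree in [xi] of the final bound. *)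
suff -> : pow32 ((1 + norm1 xi) ^+ 2 ^+ #|~: K|) = (1 + norm1 xi) ^+ (3 * #|~: K|) by [].
move: G0; move: (1 + norm1 xi) #|~: K| => G l G0.
rewrite /pow32 -exprM mulnC exprM sqrtr_sqr ger0_norm ?exprn_ge0//.
by rewrite -exprM -exprD -mulnSr mulnC.
Qed.

Lemma lik_ratio_bound : exists2 C : R, 0 < C &
  forall (t : 'I_n -> nat) beta xi, (forall i, i \notin K -> (2 <= t i)%N) ->
  lik x g s a K yK beta xi * \prod_(i in ~: K) out_ratio t beta xi i <=
  C * (1 + norm1 xi) ^+ (3 * #|~: K|).
Proof.
have /andP[s0 s1] := s01.
have [C0 C00 hC0] := marg_lik_bounded s01 a1.
have [C1 C10 hC1] := marg_lik_growth s01 a1.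
(* The decay constants depend on the observed counts, so one is chosen for each index; zero counts
   only receive a bounded factor. *)
have /choice[Cf hCf] : forall i : 'I_n, exists C : R, 0 < C /\ (i \in K -> forall th,
    marg (yK i) (expR th) <= C * (if i \in Kpos then (logw th)^-1 else 1)).
  move=> i; rewrite inE; have [y0|y0] := boolP (0 < yK i)%N.
    have [C Cp hC] := marg_lik_decay s01 a1 y0.
    by exists C; split => // -> th /=; exact: hC.
  exists C0; split => // iK th; rewrite andbF mulr1; apply: hC0; exact: expR_gt0.
have [D D0 hD] := weight_trade.
pose CK := \prod_(i in K) Cf i.
have CK0 : 0 < CK by apply: prodr_gt0 => i _; case: (hCf i).
exists (CK * (C1 / s) ^+ #|~: K| * D).
  by rewrite !mulr_gt0// exprn_gt0// divr_gt0.
move=> t beta xi t2.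
have b1 : lik x g s a K yK beta xi <= CK * \prod_(i in Kpos) (logw (lin_pred beta xi i))^-1.
  have -> : \prod_(i in Kpos) (logw (lin_pred beta xi i))^-1 =
      \prod_(i in K) (if i \in Kpos then (logw (lin_pred beta xi i))^-1 else 1).
    rewrite -big_mkcondr /=; apply: eq_bigl => i; rewrite inE.
    by case: (i \in K).
  rewrite /CK -big_split /=; apply: ler_prod => i iK.
  by rewrite (marg_lik_ge0 a s01) /= rateE; apply: (hCf i).2.
have b2 : \prod_(i in ~: K) out_ratio t beta xi i <=
    (C1 / s) ^+ #|~: K| * \prod_(i in ~: K) logw (lin_pred beta xi i).
  rewrite -prodr_const -big_split /=; apply: ler_prod => i; rewrite inE => iK.
  have := t2 i iK; rewrite /out_ratio rateE; case: (t i) => [|[|k]]// _.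
  have Hk : 0 < H k.+2%:R by apply: H_pdf_gt0; rewrite ltr0n.
  have sH : 0 < s * H k.+2%:R by rewrite mulr_gt0.
  rewrite divr_ge0 ?(marg_lik_ge0 a s01) ?(ltW sH)//= ler_pdivrMr//.
  apply: (le_trans (hC1 k _)).
  by rewrite le_eqVlt; apply/orP; left; apply/eqP; field; rewrite gt_eqF.
apply: (@le_trans _ _ ((CK * \prod_(i in Kpos) (logw (lin_pred beta xi i))^-1) *
  ((C1 / s) ^+ #|~: K| * (D * (1 + norm1 xi) ^+ (3 * #|~: K|) *
    \prod_(i in Kpos) logw (lin_pred beta xi i))))).
  apply: ler_pM => //.
  - by apply: prodr_ge0 => i _; exact: (marg_lik_ge0 a s01).
  - apply: prodr_ge0 => i _; rewrite divr_ge0 ?(marg_lik_ge0 a s01)//.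
    by rewrite mulr_ge0 ?(ltW s0) ?H_pdf_ge0.
  - apply: (le_trans b2); rewrite ler_wpM2l//.
    by rewrite exprn_ge0// divr_ge0 ?ltW.
rewrite prodfV; set Pi := \prod_(i in _) _.
have Pi0 : 0 < Pi by apply: prodr_gt0 => i _; exact: logw_gt0.
by rewrite le_eqVlt; apply/orP; left; apply/eqP; field; rewrite gt_eqF.
Qed.

Lemma measurable_dotp_snd d (T : measurableType d) k (v : k.-tuple R) (f : T -> k.-tuple R) :
  (forall j, measurable_fun setT (fun z => tnth (f z) j)) ->
  measurable_fun setT (fun z => dotp v (f z)).
Proof.
by move=> mf; rewrite /dotp; apply: measurable_sum => j; exact: measurable_funM.
Qed.

Local Notation pairT := (p.-tuple R * (n * q).-tuple R)%type.

Lemma measurable_rate i : measurable_fun setT (fun z : pairT => rate x g z.1 z.2 i).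
Proof.
apply: (measurableT_comp (@measurable_expR R)); apply: measurable_funD.
  apply: measurable_dotp_snd => j.
  exact: (measurableT_comp (measurable_tnth j)).
apply: measurable_dotp_snd => j.
under eq_fun do rewrite tnth_mktuple.
have [h|h] := ltnP (i * q + j) (n * q).
  under eq_fun do rewrite -[(i * q + j)%N]/(nat_of_ord (Ordinal h)) -tnth_nth.
  exact: (measurableT_comp (measurable_tnth (Ordinal h))).
rewrite (_ : (fun _ => _) = cst 0); first exact: measurable_cst.
by apply/funext => z; rewrite nth_default ?size_tuple.
Qed.

Lemma measurable_marg_rate k i :
  measurable_fun setT (fun z : pairT => marg k (rate x g z.1 z.2 i)).
Proof. apply: (measurableT_comp (measurable_marg_lik a s01 k)); exact: measurable_rate. Qed.

Lemma measurable_prod_in d (T : measurableType d) (S : {set 'I_n}) (f : 'I_n -> T -> R) :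
  (forall i, measurable_fun setT (f i)) ->
  measurable_fun setT (fun z => \prod_(i in S) f i z).
Proof.
move=> mf; under eq_fun do rewrite big_mkcond.
by apply: measurable_prod => i _; case: (i \in S).
Qed.

Lemma measurable_mvn_pdf : measurable_fun setT (mvn_pdf m Sigma).
Proof.
have mrow i : measurable_fun setT (fun v : (n * q).-tuple R => (row_of v - m) 0 i).
  under eq_fun do rewrite !mxE.
  by apply: measurable_funB => //; exact: measurable_tnth.
apply: measurable_funM => //; apply: measurableT_comp => //.
apply: measurable_funM => //.
under eq_fun do rewrite mxE.
apply: measurable_sum => i; apply: measurable_funM; last first.
  by under eq_fun do rewrite mxE; exact: mrow.
under eq_fun do rewrite mxE.
by apply: measurable_sum => j; apply: measurable_funM => //; exact: mrow.
Qed.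

Lemma measurable_upost S y : measurable_fun setT (fun z : pairT => upo S y z.1 z.2).
Proof.
apply: measurable_funM.
  apply: measurable_funM; first exact: measurableT_comp dpib.1 measurable_fst.
  exact: measurableT_comp measurable_mvn_pdf measurable_snd.
by apply: measurable_prod_in => i; exact: measurable_marg_rate.
Qed.

Lemma upost_setT_split (t : 'I_n -> nat) beta xi :
  (forall i, i \in K -> t i = yK i) -> (forall i, i \notin K -> (2 <= t i)%N) ->
  upo [set: 'I_n]%SET t beta xi = (\prod_(i in ~: K) (s * H (t i)%:R)) *
    (upo K yK beta xi * \prod_(i in ~: K) out_ratio t beta xi i).
Proof.
move=> tK t2; have /andP[s0 s1] := s01.
have likE : lik x g s a [set: 'I_n]%SET t beta xi = lik x g s a K yK beta xi *
    \prod_(i in ~: K) (s * H (t i)%:R * out_ratio t beta xi i).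
  rewrite /lik (big_setID K) /= finset.setTI finset.setTD; congr (_ * _).
    by apply: eq_bigr => i iK; rewrite tK.
  apply: eq_bigr => i; rewrite inE => iK.
  rewrite /out_ratio mulrC divfK// mulf_neq0 ?gt_eqF// H_pdf_gt0// ltr0n.
  exact: ltn_trans (t2 i iK).
by rewrite /upost likE big_split /=; ring.
Qed.

Lemma posterior_cvg_seq (t : nat -> 'I_n -> nat) beta xi :
  (forall k i, i \in K -> t k i = yK i) ->
  (forall k i, i \notin K -> (2 <= t k i)%N) ->
  (forall i, i \notin K -> t k i @[k --> \oo] --> \oo) ->
  post [set: 'I_n]%SET (t k) beta xi @[k --> \oo] --> post K yK beta xi.
Proof.
move=> tK t2 ty; have /andP[s0 s1] := s01.
(* The unnormalized posterior without its diverging scale; this is the integrand that is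
   dominated. *)
pose W k b z := upo K yK b z * \prod_(i in ~: K) out_ratio (t k) b z i.
pose bk k := \prod_(i in ~: K) (s * H (t k i)%:R).
have bk0 k : 0 < bk k.
  apply: prodr_gt0 => i; rewrite inE => iK; rewrite mulr_gt0// H_pdf_gt0// ltr0n.
  exact: ltn_trans (t2 k i iK).
have upoE k b z : upo [set: 'I_n]%SET (t k) b z = bk k * W k b z.
  by rewrite /W /bk; apply: upost_setT_split => i iK; [exact: tK|exact: (t2 k)].
have or0 k b z i : 0 <= out_ratio (t k) b z i.
  by rewrite divr_ge0 ?(marg_lik_ge0 a s01)// mulr_ge0 ?(ltW s0) ?H_pdf_ge0.
have W0 k b z : 0 <= W k b z.
  by rewrite mulr_ge0 ?upost_ge0// prodr_ge0.
have mW k : measurable_fun setT (fun z : pairT => W k z.1 z.2).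
  apply: measurable_funM; first exact: measurable_upost.
  apply: measurable_prod_in => i; apply: measurable_funM => //.
  exact: measurable_marg_rate.
have cW b z : W k b z @[k --> \oo] --> upo K yK b z.
  rewrite -[X in _ --> X]mulr1; apply: cvgM; first exact: cvg_cst.
  rewrite -[X in _ --> X](_ : \prod_(i in ~: K) 1 = 1 :> R); last by rewrite big1.
  apply: cvg_big => [|i]; first exact: mul_continuous.
  rewrite inE => iK.
  have h := cvg_comp _ _ (ty i iK) (marg_lik_tail s01 a1 (rate_gt0 b z i)).
  have : marg (t k i) (rate x g b z i) / H (t k i)%:R / s @[k --> \oo] --> s / s.
    by apply: cvgM; [exact: h|exact: cvg_cst].
  rewrite divff ?gt_eqF//; apply: cvg_trans; apply: near_eq_cvg; near=> k.
  by rewrite /out_ratio; move: (H _) (marg _ _) => h' m'; rewrite invfM mulrA mulrAC.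
have [c [Cm [c0 Cm0 hm]]] := mvn_pdf_ubound m pdS.
have [Cl Cl0 hl] := lik_ratio_bound.
have [Cg Cg0 hg] := @norm1_gauss_domination R (n * q) (3 * #|~: K|) c c0.
have c20 : 0 < c / 2 by rewrite divr_gt0.
have [I hI] := integral_gauss_lty c20.
pose f2 (w : (n * q).-tuple R) := Cm * Cl * Cg * \prod_(j < n * q) expR (- (c / 2 * tnth w j ^+ 2)).
have mg : measurable_fun setT (fun z : R => expR (- (c / 2 * z ^+ 2))).
  apply: measurableT_comp => //; apply: measurableT_comp => //.
  by apply: measurable_funM => //; exact: measurable_funX.
have mf2p : measurable_fun setT (fun w : (n * q).-tuple R =>
    \prod_(j < n * q) expR (- (c / 2 * tnth w j ^+ 2))).
  apply: measurable_prod => j _.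
  exact: measurableT_comp mg (measurable_tnth j).
have CCC : 0 <= Cm * Cl * Cg by rewrite !mulr_ge0 ?ltW.
have p20 (w : (n * q).-tuple R) : 0 <= \prod_(j < n * q) expR (- (c / 2 * tnth w j ^+ 2)).
  by apply: prodr_ge0 => j _; exact: expR_ge0.
have I2 : Rdint (fun w => (f2 w)%:E) = (Cm * Cl * Cg * I ^+ (n * q))%:E.
  rewrite EFinM -(Rdint_prod (n * q) (fun z => expR_ge0 _) mg hI) -RdintZl//.
  exact/measurable_EFinP.
have dom k b z : W k b z <= pib b * f2 z.
  have -> : W k b z = pib b * (mvn_pdf m Sigma z *
      (lik x g s a K yK b z * \prod_(i in ~: K) out_ratio (t k) b z i)).
    by rewrite /W /upost; ring.
  rewrite ler_wpM2l ?dpib.2.1//.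
  have hlk := hl (t k) b z (t2 k).
  have lr0 : 0 <= lik x g s a K yK b z * \prod_(i in ~: K) out_ratio (t k) b z i.
    rewrite mulr_ge0 ?prodr_ge0// => i _; exact: (marg_lik_ge0 a s01).
  apply: (le_trans (ler_pM (mvn_pdf_ge0 z) lr0 (hm z) hlk)).
  rewrite /f2 mulrACA -(mulrA (Cm * Cl)) ler_wpM2l//.
    by rewrite mulr_ge0 ?ltW.
  by rewrite mulrC; exact: hg.
have mf1 : measurable_fun setT pib by exact: dpib.1.
have [finE cvE] := @Rdint2_dominated_convergence R p (n * q) W (upo K yK) pib f2 1 _
  mW (measurable_upost K yK) mf1 (measurable_funM (measurable_cst _) mf2p)
  W0 dpib.2.1 (fun w => mulr_ge0 CCC (p20 w)) dom cW dpib.2.2 I2.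
have evE k : evidence x g s a pib m Sigma [set: 'I_n]%SET (t k) =
    bk k * fine (Rdint (fun b => Rdint (fun z => (W k b z)%:E))).
  rewrite /evidence -fine_scale// -Rdint2_scale ?(ltW (bk0 k))//.
  by congr fine; apply: eq_Rdint => b; apply: eq_Rdint => z; rewrite upoE.
have poE k : post [set: 'I_n]%SET (t k) beta xi =
    W k beta xi / fine (Rdint (fun b => Rdint (fun z => (W k b z)%:E))).
  by rewrite /posterior evE upoE -mulf_div divff ?gt_eqF// mul1r.
rewrite (_ : (fun _ => _) = (fun k => W k beta xi /
  fine (Rdint (fun b => Rdint (fun z => (W k b z)%:E))))); last exact/funext.
(* The normalization of [mvn_pdf] could only vanish if [\det Sigma <= 0]; both
   posteriors are then [0 / 0 = 0], which spares proving [0 < \det Sigma]. *)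
have [Z0|Z0] := eqVneq (Num.sqrt ((pi *+ 2) ^+ (n * q) * \det Sigma))^-1 0.
  have u0 : upo K yK beta xi = 0 by rewrite /upost /mvn_pdf Z0 mul0r mulr0 mul0r.
  rewrite /posterior u0 mul0r.
  rewrite (_ : (fun _ => _) = cst 0); first exact: cvg_cst.
  by apply/funext => k; rewrite /W /upost /mvn_pdf Z0 mul0r mulr0 !mul0r.
apply: cvgM; first exact: cW.
apply: cvgV; last exact: cvE.
(* Where [pib] is nonzero, the Gaussian density and all likelihood factors are nonzero, and [pib]
   has total mass 1; the limiting evidence is thus nonzero. *)
rewrite fine_eq0//; apply: (Rdint2_neq0 (measurable_upost K yK) mf1 (upost_ge0 K yK) dpib.2.1).
  move=> b z b0; rewrite /upost !mulf_neq0//; first by rewrite gt_eqF ?expR_gt0.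
  by rewrite gt_eqF//; apply: prodr_gt0 => i _; exact: marg_lik_gt0 (rate_gt0 _ _ _).
by rewrite dpib.2.2 onee_neq0.
Unshelve. all: by end_near. Qed.

End robustness.

Theorem theorem3 (R : realType) (n p q : nat)
  (x : 'I_n -> p.-tuple R) (g : 'I_n -> q.-tuple R) (s a : R)
  (pib : p.-tuple R -> R) (m : 'rV[R]_(n * q)) (Sigma : 'M[R]_(n * q))
  (K : {set 'I_n}) (yK : 'I_n -> nat) (y : R -> 'I_n -> nat) :
  0 < s < 1 -> 1 <= a ->
  prob_density pib -> posdef Sigma ->
  (0 < #|K|)%N -> (0 < #|~: K|)%N ->
  (forall w i, i \in K -> y w i = yK i) ->
  (forall i, i \notin K -> ((y w i)%:R : R) @[w --> +oo] --> +oo) ->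
  (#|~: K| + p <= #|[set i in K | (0 < yK i)%N]| + 1)%N ->
  (forall S : {set 'I_n}, S \subset [set i in K | (0 < yK i)%N] -> #|S| = p ->
     lin_indep x S) ->
  forall (beta : p.-tuple R) (xi : (n * q).-tuple R),
    posterior x g s a pib m Sigma [set: 'I_n]%SET (y w) beta xi @[w --> +oo] -->
    posterior x g s a pib m Sigma K yK beta xi.
Proof.
move=> s01 a1 dpib pdS _ _ yKE yinf cardK indepK beta xi.
(* Dominated convergence is sequential, so [w] is replaced by an arbitrary sequence tending to
   infinity. *)
apply/cvg_pinftyP => u uy.
(* [maxn 2] only affects finitely many indices: the uniform bounds need [2 <= y]. *)
pose t k i := if i \in K then yK i else maxn 2 (y (u k) i).
have yn i : i \notin K -> y (u k) i @[k --> \oo] --> \oo.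
  by move=> iK; apply/(cvgrnyP (R := R)); exact: cvg_comp uy (yinf i iK).
have y2 i : \forall k \near \oo, i \notin K -> (2 <= y (u k) i)%N.
  have [iK|iK] := boolP (i \in K); first by near=> k.
  have : \forall k \near \oo, (2 <= y (u k) i)%N.
    by exact: (yn i iK [set j | (2 <= j)%N] (nbhs_infty_ge 2)).
  by apply: filterS.
have tE : \forall k \near \oo, t k = y (u k).
  have hy2 : \forall k \near \oo, forall i, i \notin K -> (2 <= y (u k) i)%N.
    exact: filter_forall.
  apply: filterS hy2 => k hk.
  apply/funext => i; rewrite /t; case: ifPn => [iK|iK]; first by rewrite yKE.
  by apply/maxn_idPr; exact: hk.
have : posterior x g s a pib m Sigma [set: 'I_n]%SET (t k) beta xi @[k --> \oo] -->
    posterior x g s a pib m Sigma K yK beta xi.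
  apply: posterior_cvg_seq => // [k i iK|k i iK|i iK].
  - by rewrite /t iK.
  - by rewrite /t (negbTE iK) leq_maxl.
  - apply: cvg_trans (yn i iK); apply: near_eq_cvg.
    by apply: filterS tE => k ->.
apply: cvg_trans; apply: near_eq_cvg.
by apply: filterS tE => k ->.
Unshelve. all: by end_near. Qed.
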